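(* Let $M$ be a nonempty manifold of dimension $n\geq3$. Then the Yamabe map $Y_M\colon\mathrm{Metr}(M)\to\mathbb{R}\cup\{-\infty\}$ is upper semicontinuous with respect to the uniform $C^2$-topology on $\mathrm{Metr}(M)$. Moreover, at every metric $g\in\mathrm{Metr}(M)$ which satisfies $Y_M(g)=-\infty$, or which admits constants $\varepsilon,c\in\mathbb{R}_{>0}$ with $$|\mathrm{Ric}_g|_g\leq c\,(1+|\mathrm{scal}_g|)\ \text{ on } M\qquad\text{and}\qquad \big\|(\mathrm{scal}_g-\varepsilon)_-\big\|_{L^{n/2}(g)}<\infty,$$ the Yamabe map $Y_M$ is continuous with respect to the uniform $C^2$-topology.
   Context: Conventions: manifolds are smooth, pure-dimensional, second countable, without boundary, and not necessarily connected. $\mathrm{Metr}(M)$ is the set of smooth Riemannian metrics on $M$. Yamabe constant: for a nonempty $n$-manifold $M$ with $n\geq3$, put $p=\frac{2n}{n-2}$ and $a_n=\frac{4(n-1)}{n-2}$. For $g\in\mathrm{Metr}(M)$ and $v\in C^\infty_c(M,\mathbb{R}_{\geq0})\setminus\{0\}$ let $$E_g(v)=\frac{1}{\|v\|_{L^p(g)}^2}\int_M\big(a_n|dv|_g^2+\mathrm{scal}_g\,v^2\big)\,d\mu_g,$$ where $\mathrm{scal}_g$ is the scalar curvature and $d\mu_g$ the Riemannian density of $g$. The Yamabe constant of $g$ is $Y_M(g)=\inf\{E_g(v) : v\in C_c^\infty(M,\mathbb{R}_{\geq0})\setminus\{0\}\}\in\mathbb{R}\cup\{-\infty\}$; the Yamabe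 map is $g\mapsto Y_M(g)$. Notation: $|\mathrm{Ric}_g|_g(x)=\big(\sum_{i,j}\mathrm{Ric}_g(e_i,e_j)^2\big)^{1/2}$ for any $g$-orthonormal basis $(e_i)$ of $T_xM$, where $\mathrm{Ric}_g$ is the Ricci tensor. For a real function $f$, $f_-(x)=-\min\{0,f(x)\}$. Semicontinuity: let $X$ be a topological space and $f\colon X\to\mathbb{R}\cup\{-\infty\}$. $f$ is upper [resp. lower] semicontinuous at $x$ if: when $f(x)\in\mathbb{R}$, for every $\varepsilon>0$ there is a neighborhood $U$ of $x$ with $f(y)\leq f(x)+\varepsilon$ [resp. $f(y)\geq f(x)-\varepsilon$] for all $y\in U$; when $f(x)=-\infty$, for every $c\in\mathbb{R}$ there is a neighborhood $U$ of $x$ with $f(y)\leq c$ for all $y\in U$ [resp. no condition]. $f$ is upper semicontinuous if it is so at each point; $f$ is continuous at $x$ iff it is both upper and lower semicontinuous at $x$. Uniform $C^k$-topology on $\mathrm{Metr}(M)$ ($k\in\mathbb{N}$): the topology for which a neighborhood basis at each $g\in\mathrm{Metr}(M)$ is given by the sets $\mathcal{N}_{g,\varepsilon,k}=\{h\in\mathrm{Metr}(M): \|h-g\|_{C^k(g)}<\varepsilon\}$, $\varepsilon\in\mathbb{R}_{>0}$, where $\|h\|_{C^k(g)}=\sum_{i=0}^k\sup_{x\in M}|\nabla^ih|_g(x)\in[0,\infty]$ and $\nabla$ is the Levi-Civita connection of $g$. *)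

(* Defs.v *)
From HB Require Import structures.
From mathcomp Require Import all_boot all_order all_algebra.
From mathcomp Require Import all_classical all_reals all_analysis.
Set Implicit Arguments.
Unset Strict Implicit.
Unset Printing Implicit Defensive.
Import Order.TTheory GRing.Theory Num.Theory.
Import numFieldNormedType.Exports.
Local Open Scope classical_set_scope.
Local Open Scope ring_scope.

Section Smooth.
Context {R : realType} {n : nat}.
Implicit Types (f : 'rV[R]_n -> R) (U : set 'rV[R]_n).

Definition pd (i : 'I_n) f : 'rV[R]_n -> R :=
  fun y => 'D_(delta_mx ord0 i) f y.

(* Meant for open U. *)
Fixpoint Ck_on (k : nat) U f : Prop :=
  (forall y, U y -> {for y, continuous f}) /\
  (if k is k'.+1 then
     forall i, (forall y, U y -> derivable f y (delta_mx ord0 i)) /\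
               Ck_on k' U (pd i f)
   else True).

Definition smooth_on U f := forall k, Ck_on k U f.

End Smooth.

(* Only the restrictions of cmap to cdom and of cinv to cimg are meaningful. *)
Record chart (R : realType) (n : nat) (M : topologicalType) := Chart {
  cdom : set M;
  cmap :> M -> 'rV[R]_n;
  cinv : 'rV[R]_n -> M }.

Definition cimg R n M (c : @chart R n M) : set 'rV[R]_n := c @` cdom c.

Definition is_chart R n M (c : @chart R n M) : Prop :=
  [/\ open (cdom c), open (cimg c),
      forall x, cdom c x -> cinv c (c x) = x,
      forall x, cdom c x -> {for x, continuous c} &
      forall y, cimg c y -> {for y, continuous (cinv c)}].

(* A smooth atlas, not required to be maximal, determines the smooth
   structure; nonemptiness is carried by the pointed type. *)
Record manifold (R : realType) (n : nat) := Manifold {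
  mspace :> ptopologicalType;
  atlas : set (chart R n mspace);
  manifold_hausdorff : hausdorff_space mspace;
  manifold_second_countable : @second_countable mspace;
  atlas_chart : forall c, atlas c -> is_chart c;
  atlas_cover : forall x : mspace, exists2 c, atlas c & cdom c x;
  atlas_smooth : forall c d, atlas c -> atlas d -> forall j,
    smooth_on (c @` (cdom c `&` cdom d)) (fun y => d (cinv c y) ord0 j) }.

Section Metric.
Context {R : realType} {n : nat} (M : manifold R n).

(* Component matrices in every chart. *)
Definition mxfield := chart R n M -> 'rV[R]_n -> 'M[R]_n.

(* Entry (i, j) is the i-th partial derivative of the j-th component. *)
Definition transition_mx (c d : chart R n M) (y : 'rV[R]_n) : 'M[R]_n :=
  \matrix_(i, j) pd i (fun z => d (cinv c z) ord0 j) y.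

(* A smooth Riemannian metric, as its component matrices in the charts of the
   atlas; metric_junk makes the representation unique. *)
Record metric := Metric {
  gmx :> chart R n M -> 'rV[R]_n -> 'M[R]_n;
  metric_smooth : forall c, atlas c -> forall i j,
    smooth_on (cimg c) (fun y => gmx c y i j);
  metric_sym : forall c, atlas c -> forall y, cimg c y ->
    (gmx c y)^T = gmx c y;
  metric_pos : forall c, atlas c -> forall y, cimg c y ->
    forall u : 'rV[R]_n, u != 0 -> 0 < (u *m gmx c y *m u^T) ord0 ord0;
  metric_compat : forall c d, atlas c -> atlas d ->
    forall x, cdom c x -> cdom d x ->
    gmx c (c x) =
      transition_mx c d (c x) *m gmx d (d x) *m (transition_mx c d (c x))^T;
  metric_junk : forall c y, ~ (atlas c /\ cimg c y) -> gmx c y = 0 }.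

Definition smooth_fun (v : M -> R) :=
  forall c, atlas c -> smooth_on (cimg c) (v \o cinv c).

Definition compactly_supported (v : M -> R) :=
  compact (closure [set x | v x != 0]).

End Metric.

Section ChartCurvature.
Context {R : realType} {n : nat}.
Variable G : 'rV[R]_n -> 'M[R]_n.
Implicit Types (i j k l m : 'I_n) (y : 'rV[R]_n).

(* upper index k *)
Definition christoffel k i j y : R :=
  2^-1 * \sum_l invmx (G y) k l *
    (pd i (fun z => G z j l) y + pd j (fun z => G z i l) y
     - pd l (fun z => G z i j) y).

(* l-th component of R(d_i, d_j) d_k, where
   R(X, Y) Z = nabla_X nabla_Y Z - nabla_Y nabla_X Z - nabla_[X, Y] Z *)
Definition curvature l k i j y : R :=
  pd i (christoffel l j k) y - pd j (christoffel l i k) y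
  + \sum_m (christoffel l i m y * christoffel m j k y
            - christoffel l j m y * christoffel m i k y).

(* trace of X |-> R(X, d_j) d_k *)
Definition ricci j k y : R := \sum_i curvature i k i j y.

Definition scalar_curvature y : R :=
  \sum_i \sum_j invmx (G y) i j * ricci i j y.

(* A covariant r-tensor field on a chart domain is represented by its
   components T I y with size I = r; other values of I are irrelevant. *)
Definition mxtensor (H : 'rV[R]_n -> 'M[R]_n) : seq 'I_n -> 'rV[R]_n -> R :=
  fun I y => if I is [:: i; j] then H y i j else 0.

(* Covariant derivative; the direction of differentiation is the first index. *)
Definition covd (T : seq 'I_n -> 'rV[R]_n -> R) : seq 'I_n -> 'rV[R]_n -> R :=
  fun I y => if I is i :: J then
    pd i (T J) y
    - \sum_(s < size J) \sum_m
        christoffel m i (nth i J s) y * T (set_nth i J s m) y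
  else 0.

End ChartCurvature.

(* The rows of frame A are an orthonormal basis for the inner product A. *)
Definition frame {R : realType} {n : nat} (A : 'M[R]_n) : 'M[R]_n :=
  xget 1%:M [set E : 'M[R]_n | E *m A *m E^T = 1%:M].

(* Norm of a covariant r-tensor with respect to the inner product A: root of
   the sum of the squares of its components in an orthonormal basis. *)
Definition tensor_norm {R : realType} {n : nat} (A : 'M[R]_n) (r : nat)
    (T : seq 'I_n -> R) : R :=
  Num.sqrt (\sum_(a : r.-tuple 'I_n)
    (\sum_(b : r.-tuple 'I_n)
       (\prod_(s < r) frame A (tnth a s) (tnth b s)) * T b) ^+ 2).

Definition borel (T : ptopologicalType) := g_sigma_algebraType (@open T).

(* Lebesgue measure of Borel sets, as an iterated product measure: the value on
   A is the integral of the measures of the slices of A. *)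
Fixpoint lebesgue_n (R : realType) (n : nat) :
    set (borel 'rV[R]_n) -> \bar R :=
  match n return set (borel 'rV[R]_n) -> \bar R with
  | 0 => fun A => \d_(0 : borel 'rV[R]_0) A
  | n'.+1 => fun A => (\int[@lebesgue_measure R]_t
      lebesgue_n [set y : borel 'rV[R]_n' |
                   A (row_mx (t%:M : 'M[R]_1) (y : 'rV[R]_n'))])%E
  end.

Section Cover.
Context {R : realType} {n : nat} (M : manifold R n).

Definition good_cover (cV : nat -> chart R n M * set M) : Prop :=
  [/\ forall k, atlas (cV k).1,
      forall k, open (cV k).2,
      forall k, compact (closure (cV k).2),
      forall k, closure (cV k).2 `<=` cdom (cV k).1 &
      \bigcup_k (cV k).2 = setT].

Lemma good_nbhs (x : M) : exists c (V : set M),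
  [/\ atlas c, nbhs x V, compact (closure V) & closure V `<=` cdom c].
Proof.
have [c ac cx] := atlas_cover x.
have [oD oI cK cc ci] := atlas_chart ac.
have Ix : cimg c (c x) by exists x.
have /nbhs_ballP[e e0 be] : nbhs (c x) (cimg c) by exact: open_nbhs_nbhs.
have e20 : 0 < e / 2 by rewrite divr_gt0.
pose K := [set v : 'rV[R]_n | forall i,
  `[c x ord0 i - e / 2, c x ord0 i + e / 2]%classic (v ord0 i)].
have cptK : compact K.
  by apply: (@rV_compact _ _ (fun i =>
    `[c x ord0 i - e / 2, c x ord0 i + e / 2]%classic)) => i; exact: segment_compact.
have KI : K `<=` cimg c.
  move=> v Kv; apply: be; split => // i j; rewrite (ord1 i).
  rewrite /ball /= ltr_distlC.
  have := Kv j; rewrite /= in_itv /= => /andP[h1 h2].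
  have e2e : e / 2 < e by rewrite ltr_pdivrMr// ltr_pMr// ltr1n.
  apply/andP; split.
    by apply: lt_le_trans h1; rewrite ltrD2l ltrN2.
  by apply: le_lt_trans h2 _; rewrite ltrD2l.
have cptL : compact (cinv c @` K).
  apply: continuous_compact => //; apply: continuous_in_subspaceT => y.
  by rewrite inE => /KI /ci.
have clL : closed (cinv c @` K).
  by apply: compact_closed => //; exact: manifold_hausdorff.
have LD : cinv c @` K `<=` cdom c.
  by move=> _ [y /KI[z cz <-] <-]; rewrite cK.
exists c, (cinv c @` K); split => //.
- have nK : nbhs (c x) K.
    apply/nbhs_ballP; exists (e / 2) => // v [_ bv] i.
    have := bv ord0 i; rewrite /ball /= ltr_distlC in_itv /= => /andP[h1 h2].
    by rewrite !ltW.
  have n1 : nbhs x (c @^-1` K) := cc _ cx _ nK.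
  have n2 : nbhs x (cdom c) by exact: open_nbhs_nbhs.
  apply: (@filterS _ (nbhs x) _ (c @^-1` K `&` cdom c)); last exact: filterI.
  by move=> z [Kz dz]; exists (c z) => //; rewrite cK.
- by rewrite -(iffLR (closure_id _) clL).
- by rewrite -(iffLR (closure_id _) clL).
Qed.

Lemma good_cover_exists : exists cV, good_cover cV.
Proof.
have [B cB [Bo Bb]] := manifold_second_countable M.
have [c0 ac0 _] := atlas_cover (point : M).
pose good (p : chart R n M * set M) := [/\ atlas p.1, open p.2,
  compact (closure p.2) & closure p.2 `<=` cdom p.1].
have good0 : good (c0, set0).
  by split => //=; [exact: open0|rewrite closure0; exact: compact0
    |rewrite closure0].
have /countable_injP [f finj] := cB.
have /choice[cV cVP] : forall k, exists p, good p /\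
    (forall b c, B b -> f b = k -> good (c, b) -> p.2 = b).
  move=> k; have [[[c b] [/= Bb' fb gb]]|nex] :=
    pselect (exists p : chart R n M * set M, [/\ B p.2, f p.2 = k & good p]).
    exists (c, b); split => //= b2 c2 Bb2 fb2 _.
    by apply: finj; rewrite ?inE// fb2 fb.
  exists (c0, set0); split => // b c Bb2 fb2 gb2.
  by exfalso; apply: nex; exists (c, b).
exists cV; split; try by move=> k; have [[]] := cVP k.
rewrite -subTset => x _.
have [c [V [ac nV cptV VD]]] := good_nbhs x.
have [b [Bb1 bx] bV] := Bb x V nV.
have gb : good (c, b).
  split => //=; first exact: Bo.
    exact: subclosed_compact (@closed_closure _ _) cptV (closureS bV).
  exact: subset_trans (closureS bV) VD.
exists (f b) => //; have [_ /(_ b c Bb1 erefl gb) ->] := cVP (f b).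
exact: bx.
Qed.

(* Countably many relatively compact chart domains covering M, and the Borel
   partition of M obtained from them. All pointwise quantities below are
   tensorial, and densities obey the change of variables formula, so nothing
   depends on this choice. *)
Definition chart_cover : nat -> chart R n M * set M := projT1 (cid good_cover_exists).

Definition piece (k : nat) : set M := seqDU (fun j => (chart_cover j).2) k.

Definition chart_at (x : M) : chart R n M :=
  (chart_cover (xget 0%N [set k | piece k x])).1.

Implicit Types (g : metric M).

Definition scal g (x : M) : R :=
  let c := chart_at x in scalar_curvature (g c) (c x).

Definition ric_norm g (x : M) : R :=
  let c := chart_at x in
  tensor_norm (g c (c x)) 2
    (fun I => mxtensor (fun y => \matrix_(i, j) ricci (g c) i j y) I (c x)).

Definition differential_norm g (v : M -> R) (x : M) : R :=
  let c := chart_at x in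
  tensor_norm (g c (c x)) 1
    (fun I => if I is [:: i] then pd i (v \o cinv c) (c x) else 0).

(* |nabla^i h|_g *)
Definition nabla_norm g (i : nat) (h : mxfield M) (x : M) : R :=
  let c := chart_at x in
  tensor_norm (g c (c x)) (i + 2)
    (fun I => iter i (covd (g c)) (mxtensor (h c)) I (c x)).

Local Open Scope ereal_scope.

(* The Riemannian measure: on the chart domain of c its density is
   sqrt (det g_ij) with respect to Lebesgue measure. *)
Definition vol g : set (borel M) -> \bar R := fun A =>
  \sum_(0 <= k <oo)
    let c := (chart_cover k).1 in
    \int[@lebesgue_n R n]_(y in (c @` (A `&` piece k) : set (borel 'rV[R]_n)))
      (Num.sqrt (\det (g c y)))%:E.

Definition Lp_norm g (p : R) (f : M -> R) : \bar R :=
  (\int[vol g]_x (`|f x| `^ p)%:E) `^ p^-1.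

Definition Ck_norm g (k : nat) (h : mxfield M) : \bar R :=
  \sum_(i < k.+1) ereal_sup [set (nabla_norm g i h x)%:E | x in [set: M]].

Local Close Scope ereal_scope.

Definition energy g (v : M -> R) : R :=
  let p : R := 2 * n%:R / (n%:R - 2) in
  let a : R := 4 * (n%:R - 1) / (n%:R - 2) in
  ((fine (Lp_norm g p v)) ^+ 2)^-1 *
  fine (\int[vol g]_x (a * differential_norm g v x ^+ 2 + scal g x * v x ^+ 2)%:E)%E.

Definition yamabe g : \bar R :=
  ereal_inf [set (energy g v)%:E | v in
    [set v : M -> R | [/\ smooth_fun v, compactly_supported v,
                          forall x, 0 <= v x & exists x, v x != 0]]].

End Cover.

(* f_- *)
Definition negpart {R : realType} (t : R) : R := - Num.min 0 t.

Section UniformTopology.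
Context {R : realType} {n : nat}.

Definition Ck_ball (M : manifold R n) (k : nat) (g : metric M) (e : R) :
    set (metric M) :=
  [set h : metric M |
    (Ck_norm g k (fun c y => h c y - g c y)%R < e%:E)%E].

(* Metr(M) with the uniform C^k-topology, given by its neighborhood filters:
   U is a neighborhood of g iff it contains some Ck_ball k g e. *)
Definition metr (k : nat) (M : manifold R n) := metric M.

HB.instance Definition _ k M := gen_eqMixin (metr k M).
HB.instance Definition _ k M := gen_choiceMixin (metr k M).
HB.instance Definition _ k M := hasNbhs.Build (metr k M)
  (fun g => filter_from [set e : R | 0 < e] (Ck_ball k g)).

End UniformTopology.

(* Semicontinuity of functions with values in the reals and -oo; no condition
   is imposed at the excluded value +oo. *)
Section Semicontinuity.
Context {R : realType} {X : nbhsType}.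
Implicit Types (f : X -> \bar R) (x : X).
Local Open Scope ereal_scope.

Definition usc_at f x : Prop :=
  match f x with
  | r%:E => forall e : R, (0 < e)%R ->
      exists2 U, nbhs x U & forall y, U y -> f y <= r%:E + e%:E
  | -oo => forall c : R, exists2 U, nbhs x U & forall y, U y -> f y <= c%:E
  | +oo => True
  end.

Definition lsc_at f x : Prop :=
  match f x with
  | r%:E => forall e : R, (0 < e)%R ->
      exists2 U, nbhs x U & forall y, U y -> r%:E - e%:E <= f y
  | _ => True
  end.

Definition usc f : Prop := forall x, usc_at f x.

Definition sc_continuous_at f x : Prop := usc_at f x /\ lsc_at f x.

End Semicontinuity.

(* Main.v *)
Require Import Defs.
From HB Require Import structures.
From mathcomp Require Import all_boot all_order all_algebra.
From mathcomp Require Import all_classical all_reals all_analysis.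
From mathcomp Require Import measurable_realfun.
From mathcomp Require Import ring lra.
Set Implicit Arguments.
Unset Strict Implicit.
Unset Printing Implicit Defensive.
Import Order.TTheory GRing.Theory Num.Theory.
Import numFieldNormedType.Exports.
Local Open Scope classical_set_scope.
Local Open Scope ring_scope.

(* If h lies in a small uniform C^2-ball around g, then in a g-orthonormal
   frame the difference of the two Levi-Civita connections and its covariant
   derivative are small. So the volume densities and the norms of covectors
   change by factors close to 1, and |scal_h - scal_g| <= eta (1 + |Ric_g|).
   Let F_g(v) be the integral of a |dv|^2 + (1 + |scal_g|) v^2. Wherever |Ric_g|
   is dominated by 1 + |scal_g| on the support of v, this yields
   |E_h(v) - E_g(v)| <= eta F_g(v) / ||v||_p^2.
   For a fixed v domination is automatic by compactness of the support, and
   taking v almost optimal for g gives upper semicontinuity. For lower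
   semicontinuity, 1 + |s| <= (1 + 1/eps) s + (2 + 1/eps) (s - eps)_- together
   with Hoelder's inequality bounds F_g(v) by A E_g(v) ||v||_p^2 + B ||v||_p^2
   with constants A, B independent of v. *)

(** * Orthonormal frames and tensor norms *)

(** Since M may be noncompact, the pointwise estimates need constants that depend only on the
    dimension and the tolerance, never on the point; this is why all tensors are compared through
    their components in a g-orthonormal frame. The difference A of the connections is lowered with h
    rather than g: the h-connection preserves h, so the first covariant derivative of h - g is
    exactly a symmetrisation of the lowered A, and the permutation trick of Koszul's formula inverts
    it. The derivative of A is recovered in the same way, up to products of two small tensors. The
    norm of Ric_g appears because scal_h - scal_g contains the trace of Ric_g against h^-1 - g^-1,
    and such a trace is not controlled by scal_g. For the lower bound the error eta (A E_g(v) + B),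
    with A and B now constants, is unbounded over test functions; it is harmless because for eta A
    <= 1 the quantity (1 - eta A) E_g(v) is still minimised at the infimum of E_g. Each pointwise
    quantity is computed in the one chart attached to the piece containing the point, and g and h
    are compared in that chart. *)

Section Frames.
Context {R : realType}.

Definition posdef n (A : 'M[R]_n) :=
  forall u : 'rV[R]_n, u != 0 -> 0 < (u *m A *m u^T) ord0 ord0.

(** Gram-Schmidt as block elimination: clearing the first row and column leaves the Schur
    complement, which is again symmetric and positive definite, so induction applies to it. *)
Lemma posdef_orthonormal n (A : 'M[R]_n) : A^T = A -> posdef A ->
  exists E : 'M[R]_n, E *m A *m E^T = 1%:M.
Proof.
elim: n A => [|n IH] A sA pA; first by exists 0; apply/matrixP => -[].
move: A sA pA; rewrite -[n.+1]/(1 + n)%N => A sA pA.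
pose a := A ord0 ord0.
have a0 : 0 < a.
  have := pA (delta_mx ord0 ord0).
  rewrite -rowE mxE (bigD1 ord0)//= !mxE !eqxx mulr1 big1 ?addr0.
    apply; apply/eqP => /matrixP/(_ ord0 ord0); rewrite !mxE !eqxx.
    by move/eqP; rewrite oner_eq0.
  by move=> j j0; rewrite !mxE eqxx (negbTE j0) mulr0.
pose b : 'rV[R]_n := ursubmx A; pose D := drsubmx A.
have Ab : A = block_mx a%:M b b^T D.
  rewrite -[LHS]submxK; congr block_mx.
    apply/matrixP => i j; rewrite !ord1 !mxE eqxx mulr1n /a.
    by congr (A _ _); apply: val_inj.
  by rewrite /b trmx_ursub sA.
(* The elimination matrix; [S] is the Schur complement of the corner entry [a]. *)
pose L : 'M[R]_(1 + n) := block_mx 1%:M 0 (- a^-1 *: b^T) 1%:M.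
pose S := D - a^-1 *: (b^T *m b).
have LAL : L *m A *m L^T = block_mx a%:M 0 0 S.
  rewrite Ab /L tr_block_mx !trmx1 trmx0 !linearZ /= trmxK.
  rewrite !mulmx_block !mul1mx !mul0mx !mulmx1 !mulmx0 !addr0.
  have E1 : - a^-1 *: b^T *m a%:M + b^T = 0.
    rewrite mul_mx_scalar scalerA mulrN divff ?gt_eqF//.
    by rewrite scaleN1r addNr.
  have E2 : a%:M *m (- a^-1 *: b) + b = 0.
    rewrite mul_scalar_mx scalerA mulrN divff ?gt_eqF//.
    by rewrite scaleN1r addNr.
  rewrite E1 E2 mul0mx add0r; congr block_mx.
  by rewrite -scalemxAl scaleNr addrC.
have uL : L \in unitmx by rewrite unitmxE det_lblock !det1 mulr1 unitr1.
have pB : posdef (block_mx a%:M 0 0 S : 'M[R]_(1 + n)).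
  move=> u u0; rewrite -LAL.
  have := pA (u *m L); rewrite trmx_mul !mulmxA; apply.
  apply: contraNneq u0 => uL0.
  by rewrite -[u](mulmxK uL) uL0 mul0mx.
have [E' E'P] : exists E : 'M[R]_n, E *m S *m E^T = 1%:M.
  apply: IH.
    have : (block_mx a%:M 0 0 S)^T = block_mx a%:M 0 0 S :> 'M[R]_(1 + n).
      by rewrite -LAL !trmx_mul trmxK sA mulmxA.
    by rewrite tr_block_mx => /eq_block_mx[].
  move=> w w0; have := pB (row_mx 0 w).
  rewrite mul_row_block !mul0mx !mulmx0 addr0 add0r tr_row_mx mul_row_col.
  rewrite mul0mx add0r; apply.
  apply: contraNneq w0 => w0'; have := congr1 (@rsubmx _ _ _ _) w0'.
  by rewrite row_mxKr => ->; apply/eqP/matrixP => i j; rewrite !mxE.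
exists (block_mx (Num.sqrt a)^-1%:M 0 0 E' *m L).
rewrite trmx_mul !mulmxA -(mulmxA _ L A) -(mulmxA _ (L *m A)) LAL.
rewrite tr_block_mx !trmx0 tr_scalar_mx !mulmx_block.
rewrite !(mul0mx, mulmx0, addr0, add0r) E'P -!scalar_mxM.
suff -> : (Num.sqrt a)^-1 * a * (Num.sqrt a)^-1 = 1 by rewrite -scalar_mx_block.
rewrite -{2}(sqr_sqrtr (ltW a0)); field.
by rewrite sqrtr_eq0 -ltNge.
Qed.

Variables (n : nat) (A : 'M[R]_n).
Hypotheses (sA : A^T = A) (pA : posdef A).

Lemma frameP : frame A *m A *m (frame A)^T = 1%:M.
Proof.
rewrite /frame; have [E EP] := posdef_orthonormal sA pA.
exact: (@xgetPex _ _ [set E : 'M[R]_n | E *m A *m E^T = 1%:M] (ex_intro _ E EP)).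
Qed.

Lemma frame_unit : frame A \in unitmx.
Proof. by have := frameP; rewrite -mulmxA => /mulmx1_unit[]. Qed.

Lemma posdef_unit : A \in unitmx.
Proof.
have := frameP; rewrite -mulmxA => /mulmx1C.
by rewrite -mulmxA => /mulmx1_unit[].
Qed.

(** Turns contractions with the inverse metric into plain sums over the frame. *)
Lemma frame_inv : invmx A = (frame A)^T *m frame A.
Proof.
have := frameP; rewrite -mulmxA => /mulmx1C; rewrite -mulmxA => h.
by rewrite -[RHS](mulKmx posdef_unit) h mulmx1.
Qed.

Lemma frame_det : \det (frame A) ^+ 2 * \det A = 1.
Proof.
by have /(congr1 determinant) := frameP; rewrite !det_mulmx det_tr det1 => <-; ring.
Qed.

Lemma posdef_det : 0 < \det A.
Proof.
have : 0 < \det (frame A) ^+ 2 * \det A by rewrite frame_det.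
have d2 : 0 < \det (frame A) ^+ 2.
  rewrite exprn_even_gt0//=; have := frame_unit; by rewrite unitmxE unitfE.
by rewrite pmulr_rgt0.
Qed.

End Frames.

Section TensorNorm.
Context {R : realType} {n : nat}.
Implicit Types (T : seq 'I_n -> R) (E A : 'M[R]_n).

Lemma big_cons_tuple r (F : r.+1.-tuple 'I_n -> R) :
  \sum_(b : r.+1.-tuple 'I_n) F b =
  \sum_i \sum_(b : r.-tuple 'I_n) F [tuple of i :: b].
Proof.
rewrite pair_big /=.
rewrite (reindex (fun p : 'I_n * r.-tuple 'I_n => [tuple of p.1 :: p.2]))//=.
exists (fun t : r.+1.-tuple 'I_n => (thead t, [tuple of behead t])).
  by move=> [i b] _ /=; congr (_, _); apply: val_inj.
by move=> t _; rewrite [RHS]tuple_eta.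
Qed.

(* Component of T along the rows s of E. *)
Fixpoint hat E (s : seq 'I_n) T : R :=
  if s is a :: s' then \sum_i E a i * hat E s' (fun I => T (i :: I)) else T [::].

(** Peeling off one index at a time replaces the sums over tuples by nested sums, which can be
    manipulated slot by slot. *)
Lemma hatE E r (a : r.-tuple 'I_n) T :
  \sum_(b : r.-tuple 'I_n) (\prod_(s < r) E (tnth a s) (tnth b s)) * T b =
  hat E a T.
Proof.
elim: r a T => [|r IH] a T.
  rewrite (tuple0 a) /= (big_pred1 [tuple]) ?big_ord0 ?mul1r// => b.
  by apply/esym/eqP; exact: tuple0.
rewrite big_cons_tuple; case/tupleP: a => a s /=; apply: eq_bigr => i _.
rewrite -IH mulr_sumr; apply: eq_bigr => b _; rewrite big_ord_recl mulrA.
by rewrite !tnth0; congr (_ * _ * _); apply: eq_bigr => k _; rewrite !tnthS.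
Qed.

Lemma tensor_normE A r T : tensor_norm A r T =
  Num.sqrt (\sum_(a : r.-tuple 'I_n) hat (frame A) a T ^+ 2).
Proof. by rewrite /tensor_norm; under eq_bigr do rewrite hatE. Qed.

Lemma tensor_norm_ge0 A r T : 0 <= tensor_norm A r T.
Proof. exact: sqrtr_ge0. Qed.

(** The closeness of two metrics is used only in this form: each frame component of the covariant
    derivatives of their difference is small. *)
Lemma hat_le_tensor_norm A (s : seq 'I_n) T :
  `|hat (frame A) s T| <= tensor_norm A (size s) T.
Proof.
rewrite tensor_normE -sqrtr_sqr ler_wsqrtr// (bigD1 (in_tuple s))//= lerDl.
by apply: sumr_ge0 => a _; exact: sqr_ge0.
Qed.

(** [frame] is an arbitrary choice at each point and need not vary continuously. The squared norm is
    free of it, so it is the square whose continuity and measurability are established later. *)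
Lemma tensor_norm1_sqr A T : A^T = A -> posdef A ->
  tensor_norm A 1 T ^+ 2 = \sum_i \sum_j invmx A i j * (T [:: i] * T [:: j]).
Proof.
move=> sA pA; rewrite tensor_normE sqr_sqrtr; last first.
  by apply: sumr_ge0 => a _; exact: sqr_ge0.
rewrite big_cons_tuple frame_inv//.
transitivity (\sum_i (\sum_j frame A i j * T [:: j]) ^+ 2).
  apply: eq_bigr => i _; rewrite (big_pred1 [tuple])// => b.
  by apply/esym/eqP; exact: tuple0.
transitivity (\sum_a \sum_i \sum_j (frame A a i * T [:: i]) * (frame A a j * T [:: j])).
  apply: eq_bigr => a _; rewrite expr2 mulr_suml; apply: eq_bigr => i _.
  by rewrite mulr_sumr.
rewrite exchange_big; apply: eq_bigr => i _ /=.
rewrite exchange_big; apply: eq_bigr => j _ /=.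
rewrite mxE mulr_suml; apply: eq_bigr => a _; rewrite mxE; ring.
Qed.

End TensorNorm.

(** * Calculus of C^k functions on open sets *)

Section PartialDerivatives.
Context {R : realType} {n : nat}.
Implicit Types (f g : 'rV[R]_n -> R) (U : set 'rV[R]_n) (y : 'rV[R]_n).

Definition drv (i : 'I_n) f y := derivable f y (delta_mx ord0 i).

Lemma near_open U y (P : 'rV[R]_n -> Prop) :
  open U -> U y -> (forall z, U z -> P z) -> \forall z \near y, P z.
Proof.
move=> oU Uy UP; apply: filterS (open_nbhs_nbhs _); last by split; eassumption.
exact: UP.
Qed.

Lemma near_drv i f g y :
  (\forall z \near y, f z = g z) -> drv i f y -> drv i g y.
Proof. exact: near_eq_derivable. Qed.

Lemma near_pd i f g y : (\forall z \near y, f z = g z) -> pd i f y = pd i g y.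
Proof. exact: near_eq_derive. Qed.

Lemma drv_cst i (a : R) y : drv i (fun=> a) y.
Proof. exact: derivable_cst. Qed.

Lemma pd_cst i (a : R) y : pd i (fun=> a) y = 0.
Proof. exact: derive_cst. Qed.

Lemma drvD i f g y : drv i f y -> drv i g y -> drv i (fun z => f z + g z) y.
Proof. exact: derivableD. Qed.

Lemma pdD i f g y : drv i f y -> drv i g y ->
  pd i (fun z => f z + g z) y = pd i f y + pd i g y.
Proof. exact: deriveD. Qed.

Lemma drvB i f g y : drv i f y -> drv i g y -> drv i (fun z => f z - g z) y.
Proof. exact: derivableB. Qed.

Lemma pdB i f g y : drv i f y -> drv i g y ->
  pd i (fun z => f z - g z) y = pd i f y - pd i g y.
Proof. exact: deriveB. Qed.

Lemma drvM i f g y : drv i f y -> drv i g y -> drv i (fun z => f z * g z) y.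
Proof. exact: derivableM. Qed.

Lemma pdM i f g y : drv i f y -> drv i g y ->
  pd i (fun z => f z * g z) y = pd i f y * g y + f y * pd i g y.
Proof.
move=> df dg; apply: etrans (deriveM df dg) _.
by rewrite addrC [g y *: _]mulrC.
Qed.

Lemma drvV i f y : f y != 0 -> drv i f y -> drv i (fun z => (f z)^-1) y.
Proof. exact: derivableV. Qed.

Lemma pdV i f y : f y != 0 -> drv i f y ->
  pd i (fun z => (f z)^-1) y = - (f y)^-1 * (f y)^-1 * pd i f y.
Proof. by move=> f0 df; rewrite /pd deriveV// expr2 invfM mulNr. Qed.

Lemma drv_sum (I : Type) (r : seq I) i (F : I -> 'rV[R]_n -> R) y :
  (forall k, drv i (F k) y) -> drv i (fun z => \sum_(k <- r) F k z) y.
Proof.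
move=> dF; elim: r => [|k r IH].
  by under eq_fun do rewrite big_nil; exact: drv_cst.
by under eq_fun do rewrite big_cons; exact: drvD.
Qed.

Lemma pd_sum (I : Type) (r : seq I) i (F : I -> 'rV[R]_n -> R) y :
  (forall k, drv i (F k) y) ->
  pd i (fun z => \sum_(k <- r) F k z) y = \sum_(k <- r) pd i (F k) y.
Proof.
move=> dF; elim: r => [|k r IH].
  by under eq_fun do rewrite big_nil; rewrite big_nil pd_cst.
under eq_fun do rewrite big_cons; rewrite big_cons pdD ?IH//.
exact: drv_sum.
Qed.

Lemma Ck_on_ext k U f g : open U -> (forall y, U y -> f y = g y) ->
  Ck_on k U f -> Ck_on k U g.
Proof.
move=> oU; elim: k f g => [|k IH] f g fg [cf df];
  have fgn y (Uy : U y) : \forall z \near y, f z = g z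
    by apply: (near_open oU Uy) => z; exact: fg.
all: have cg y : U y -> {for y, continuous g}
  by move=> Uy; suff : g @ y --> g y by [];
  rewrite -(fg y Uy); apply: cvg_trans (cf y Uy); exact: near_eq_cvg (fgn y Uy).
all: split => //.
move=> i; have [di ci] := df i; split.
  by move=> y Uy; apply: (@near_drv _ f); [exact: fgn|exact: di].
by apply: IH ci => y Uy; apply: near_pd; exact: fgn.
Qed.

Lemma Ck_on_lt k U f : Ck_on k.+1 U f -> Ck_on k U f.
Proof.
elim: k f => [|k IH] f [cf df]; first by split.
by split => // i; have [di ci] := df i; split => //; exact: IH.
Qed.

Lemma Ck_on_cont k U f y : Ck_on k U f -> U y -> {for y, continuous f}.
Proof. by case: k => [|k] [cf _]; exact: cf. Qed.

Lemma Ck_on_drv k U f y i : Ck_on k.+1 U f -> U y -> drv i f y.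
Proof. by move=> [_ /(_ i)[di _]]; exact: di. Qed.

Lemma Ck_on_pd k U f i : Ck_on k.+1 U f -> Ck_on k U (pd i f).
Proof. by move=> [_ /(_ i)[]]. Qed.

Lemma Ck_on_cst k U (a : R) : Ck_on k U (fun=> a).
Proof.
have cf y : U y -> {for y, continuous (fun=> a : R)}.
  by move=> _; exact: cst_continuous.
elim: k a cf => [|k IH] a cf; split => //.
move=> i; split; first by move=> y _; exact: drv_cst.
rewrite (_ : pd i _ = fun=> 0); last by apply/funext => y; rewrite pd_cst.
by apply: IH => y _; exact: cst_continuous.
Qed.

Lemma Ck_onD k U f g : open U -> Ck_on k U f -> Ck_on k U g ->
  Ck_on k U (fun z => f z + g z).
Proof.
move=> oU; elim: k f g => [|k IH] f g [cf df] [cg dg]; split => //;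
  try by move=> y Uy; exact: continuousD (cf y Uy) (cg y Uy).
move=> i; have [di ci] := df i; have [di' ci'] := dg i; split.
  by move=> y Uy; apply: drvD; [exact: di|exact: di'].
apply: Ck_on_ext (IH _ _ ci ci') => // y Uy.
by rewrite pdD//; [exact: di|exact: di'].
Qed.

Lemma Ck_onM k U f g : open U -> Ck_on k U f -> Ck_on k U g ->
  Ck_on k U (fun z => f z * g z).
Proof.
move=> oU; elim: k f g => [|k IH] f g Cf Cg; have [cf df] := Cf;
  have [cg dg] := Cg; split => //;
  try by move=> y Uy; exact: continuousM (cf y Uy) (cg y Uy).
move=> i; have [di ci] := df i; have [di' ci'] := dg i; split.
  by move=> y Uy; apply: drvM; [exact: di|exact: di'].
have := Ck_onD oU (IH _ _ ci (Ck_on_lt Cg)) (IH _ _ (Ck_on_lt Cf) ci').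
by apply: Ck_on_ext => // y Uy; rewrite pdM//; [exact: di|exact: di'].
Qed.

Lemma Ck_onN k U f : open U -> Ck_on k U f -> Ck_on k U (fun z => - f z).
Proof.
move=> oU Cf; have := Ck_onM oU (@Ck_on_cst k U (-1)) Cf.
by apply: Ck_on_ext => // y _; rewrite mulN1r.
Qed.

Lemma Ck_onB k U f g : open U -> Ck_on k U f -> Ck_on k U g ->
  Ck_on k U (fun z => f z - g z).
Proof. by move=> oU Cf Cg; apply: Ck_onD => //; exact: Ck_onN. Qed.

Lemma Ck_onV k U f : open U -> (forall y, U y -> f y != 0) ->
  Ck_on k U f -> Ck_on k U (fun z => (f z)^-1).
Proof.
move=> oU f0; elim: k => [|k IH] Cf; have [cf df] := Cf; split => //;
  try by move=> y Uy; exact: continuousV (f0 y Uy) (cf y Uy).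
move=> i; have [di ci] := df i; split.
  by move=> y Uy; apply: drvV; [exact: f0|exact: di].
have CV := IH (Ck_on_lt Cf).
have := Ck_onM oU (Ck_onM oU (Ck_onN oU CV) CV) ci.
by apply: Ck_on_ext => // y Uy; rewrite pdV//; [exact: f0|exact: di].
Qed.

Lemma Ck_on_sum (I : Type) (r : seq I) k U (F : I -> 'rV[R]_n -> R) :
  open U -> (forall j, Ck_on k U (F j)) ->
  Ck_on k U (fun z => \sum_(j <- r) F j z).
Proof.
move=> oU CF; elim: r => [|j r IH].
  by under eq_fun do rewrite big_nil; exact: Ck_on_cst.
by under eq_fun do rewrite big_cons; exact: Ck_onD.
Qed.

Lemma Ck_on_prod (I : Type) (r : seq I) k U (F : I -> 'rV[R]_n -> R) :
  open U -> (forall j, Ck_on k U (F j)) ->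
  Ck_on k U (fun z => \prod_(j <- r) F j z).
Proof.
move=> oU CF; elim: r => [|j r IH].
  by under eq_fun do rewrite big_nil; exact: Ck_on_cst.
by under eq_fun do rewrite big_cons; exact: Ck_onM.
Qed.

Lemma Ck_on_det k U p (A : 'rV[R]_n -> 'M[R]_p) : open U ->
  (forall i j, Ck_on k U (fun z => A z i j)) -> Ck_on k U (fun z => \det (A z)).
Proof.
move=> oU CA; rewrite /determinant.
apply: Ck_on_sum => // s; apply: Ck_onM => //; first exact: Ck_on_cst.
by apply: Ck_on_prod.
Qed.

(** Cramer's rule: the entries are cofactors, polynomial in the entries of [A], divided by the
    nonvanishing determinant. *)
Lemma Ck_on_invmx k U p (A : 'rV[R]_n -> 'M[R]_p) : open U ->
  (forall y, U y -> A y \in unitmx) ->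
  (forall i j, Ck_on k U (fun z => A z i j)) ->
  forall i j, Ck_on k U (fun z => invmx (A z) i j).
Proof.
move=> oU uA CA i j.
apply: (@Ck_on_ext _ _ (fun z => (\det (A z))^-1 * \adj (A z) i j)) => //.
  by move=> y Uy; rewrite /invmx (uA y Uy) [RHS]mxE.
apply: Ck_onM => //.
  apply: Ck_onV => //; last exact: Ck_on_det.
  by move=> y /uA; rewrite unitmxE unitfE.
under eq_fun do rewrite mxE; rewrite /cofactor.
apply: Ck_onM => //; first exact: Ck_on_cst.
apply: Ck_on_det => // a b; under eq_fun do rewrite !mxE.
exact: CA.
Qed.

End PartialDerivatives.

(** * Difference of two Levi-Civita connections *)

Lemma sum_invmx_mul {R : fieldType} n (A : 'M[R]_n) (f : 'I_n -> R) k :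
  A \in unitmx ->
  \sum_m (\sum_l invmx A m l * f l) * A k m = f k.
Proof.
move=> uA; transitivity (\sum_l (A *m invmx A) k l * f l); last first.
  rewrite mulmxV// (bigD1 k)//= mxE eqxx mul1r big1 ?addr0// => l lk.
  by rewrite mxE eq_sym (negbTE lk) mul0r.
under eq_bigr do rewrite mulr_suml.
rewrite exchange_big /=; apply: eq_bigr => l _.
rewrite mxE mulr_suml; apply: eq_bigr => m _.
by rewrite mulrC mulrA.
Qed.

Section Covd.
Context {R : realType} {n : nat}.
Variables (G : 'rV[R]_n -> 'M[R]_n) (T : seq 'I_n -> 'rV[R]_n -> R).

Lemma covdE2 i j k y : covd G T [:: i; j; k] y =
  pd i (T [:: j; k]) y - \sum_m christoffel G m i j y * T [:: m; k] y
  - \sum_m christoffel G m i k y * T [:: j; m] y.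
Proof. by rewrite /covd /= !big_ord_recl big_ord0 /= addr0 opprD addrA. Qed.

Lemma covdE3 a i j k y : covd G T [:: a; i; j; k] y =
  pd a (T [:: i; j; k]) y - \sum_m christoffel G m a i y * T [:: m; j; k] y
  - \sum_m christoffel G m a j y * T [:: i; m; k] y
  - \sum_m christoffel G m a k y * T [:: i; j; m] y.
Proof. by rewrite /covd /= !big_ord_recl big_ord0 /= addr0 !opprD !addrA. Qed.

End Covd.

Section Christoffel.
Context {R : realType} {n : nat}.
Variables (U : set 'rV[R]_n) (G : 'rV[R]_n -> 'M[R]_n).
Hypothesis oU : open U.
Hypothesis Gsym : forall y, U y -> (G y)^T = G y.
Hypothesis Gunit : forall y, U y -> G y \in unitmx.

Lemma mx_symE y i j : U y -> G y i j = G y j i.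
Proof. by move=> Uy; rewrite -[in LHS](Gsym Uy) mxE. Qed.

Lemma pd_symE l y i j : U y ->
  pd l (fun z => G z i j) y = pd l (fun z => G z j i) y.
Proof.
move=> Uy; apply: near_pd; apply: (near_open oU Uy) => z Uz; exact: mx_symE.
Qed.

Lemma christoffel_sym k i j y : U y -> christoffel G k i j y = christoffel G k j i y.
Proof.
move=> Uy; rewrite /christoffel; congr (_ * _); apply: eq_bigr => l _.
congr (_ * _); rewrite (pd_symE l i j Uy); ring.
Qed.

Lemma christoffel_lower i j k y : U y -> \sum_m christoffel G m i j y * G y m k =
  2^-1 * (pd i (fun z => G z j k) y + pd j (fun z => G z i k) y
     - pd k (fun z => G z i j) y).
Proof.
move=> Uy; rewrite -(sum_invmx_mul (fun l => pd i (fun z => G z j l) y +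
   pd j (fun z => G z i l) y - pd l (fun z => G z i j) y) k (Gunit Uy)).
rewrite mulr_sumr; apply: eq_bigr => m _.
by rewrite /christoffel (mx_symE k m Uy) mulrA.
Qed.

(** Compatibility of the Levi-Civita connection with its metric, nabla G = 0, in coordinates. *)
Lemma pd_metric i j k y : U y -> pd i (fun z => G z j k) y =
  \sum_m christoffel G m i j y * G y m k + \sum_m christoffel G m i k y * G y m j.
Proof.
move=> Uy; rewrite !christoffel_lower//.
rewrite (pd_symE i k j Uy); lra.
Qed.

Lemma Ck_on_christoffel k : (forall i j, Ck_on k.+1 U (fun z => G z i j)) ->
  forall l i j, Ck_on k U (christoffel G l i j).
Proof.
move=> CG l i j; rewrite /christoffel; apply: Ck_onM => //; first exact: Ck_on_cst.
apply: Ck_on_sum => // m; apply: Ck_onM => //.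
  by apply: Ck_on_invmx => // a b; exact: Ck_on_lt.
by apply: Ck_onB => //; first apply: Ck_onD => //; exact: Ck_on_pd.
Qed.

Lemma Ck_on_ricci k : (forall i j, Ck_on k.+2 U (fun z => G z i j)) ->
  forall i j, Ck_on k U (ricci G i j).
Proof.
move=> CG i j; rewrite /ricci /curvature.
have CC := Ck_on_christoffel CG.
apply: Ck_on_sum => // a; apply: Ck_onD => //.
  by apply: Ck_onB => //; exact: Ck_on_pd.
apply: Ck_on_sum => // b; apply: Ck_onB => //; apply: Ck_onM => //; exact: Ck_on_lt.
Qed.

Lemma Ck_on_scalar k : (forall i j, Ck_on k.+2 U (fun z => G z i j)) ->
  Ck_on k U (scalar_curvature G).
Proof.
move=> CG; rewrite /scalar_curvature.
apply: Ck_on_sum => // a; apply: Ck_on_sum => // b; apply: Ck_onM => //.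
  by apply: Ck_on_invmx => // i j; do 2 apply: Ck_on_lt.
exact: Ck_on_ricci.
Qed.

End Christoffel.

Arguments covd : simpl never.
#[local] Opaque christoffel covd.

Section MetricDifference.
Context {R : realType} {n : nat}.
Variables (U : set 'rV[R]_n) (G H : 'rV[R]_n -> 'M[R]_n).
Hypothesis oU : open U.
Hypothesis Gsym : forall y, U y -> (G y)^T = G y.
Hypothesis Gunit : forall y, U y -> G y \in unitmx.
Hypothesis Hsym : forall y, U y -> (H y)^T = H y.
Hypothesis Hunit : forall y, U y -> H y \in unitmx.
Hypothesis CG : forall i j, Ck_on 2 U (fun z => G z i j).
Hypothesis CH : forall i j, Ck_on 2 U (fun z => H z i j).
Implicit Types (a b i j k l m : 'I_n).

Definition conn_diff m i j y : R := christoffel H m i j y - christoffel G m i j y.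

(** Lowering with [H], which its own connection preserves, makes [covd_diff] an exact identity. *)
Definition conn_diff_low i j k y : R := \sum_m conn_diff m i j y * H y m k.

(** The covariant derivative, for the connection of [G], of the (1,2)-tensor [conn_diff]; [covd]
    treats covariant tensors only, so the term of the upper index [m] is written out. *)
Definition nabla_conn_diff a m i j y : R :=
  pd a (conn_diff m i j) y + \sum_b christoffel G m a b y * conn_diff b i j y
  - \sum_b christoffel G b a i y * conn_diff m b j y
  - \sum_b christoffel G b a j y * conn_diff m i b y.

(** The index is lowered after differentiating. This differs from the derivative of [conn_diff_low],
    because the connection of [G] does not preserve [H]. *)
Definition nabla_conn_diff_low a i j k y : R :=
  \sum_m nabla_conn_diff a m i j y * H y m k.

Local Notation T := (mxtensor (fun z => H z - G z)).

Lemma conn_diff_sym m i j y : U y -> conn_diff m i j y = conn_diff m j i y.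
Proof.
move=> Uy; rewrite /conn_diff (christoffel_sym oU Gsym m i j Uy).
by rewrite (christoffel_sym oU Hsym m i j Uy).
Qed.

Lemma conn_diff_low_sym i j k y : U y ->
  conn_diff_low i j k y = conn_diff_low j i k y.
Proof. by move=> Uy; apply: eq_bigr => m _; rewrite (conn_diff_sym _ _ _ Uy). Qed.

Lemma nabla_conn_diff_sym a m i j y : U y ->
  nabla_conn_diff a m i j y = nabla_conn_diff a m j i y.
Proof.
move=> Uy; rewrite /nabla_conn_diff.
have -> : pd a (conn_diff m i j) y = pd a (conn_diff m j i) y.
  by apply: near_pd; apply: (near_open oU Uy) => z Uz; exact: conn_diff_sym.
have -> : \sum_b christoffel G m a b y * conn_diff b i j y =
    \sum_b christoffel G m a b y * conn_diff b j i y.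
  by apply: eq_bigr => b _; rewrite (conn_diff_sym b i j Uy).
have -> : \sum_b christoffel G b a i y * conn_diff m b j y =
    \sum_b christoffel G b a i y * conn_diff m j b y.
  by apply: eq_bigr => b _; rewrite (conn_diff_sym m b j Uy).
have -> : \sum_b christoffel G b a j y * conn_diff m i b y =
    \sum_b christoffel G b a j y * conn_diff m b i y.
  by apply: eq_bigr => b _; rewrite (conn_diff_sym m i b Uy).
exact: addrAC.
Qed.

Lemma nabla_conn_diff_low_sym a i j k y : U y ->
  nabla_conn_diff_low a i j k y = nabla_conn_diff_low a j i k y.
Proof.
by move=> Uy; apply: eq_bigr => m _; rewrite (nabla_conn_diff_sym _ _ _ _ Uy).
Qed.

Lemma drv_christoffel a l i j y : U y ->
  drv a (christoffel G l i j) y /\ drv a (christoffel H l i j) y.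
Proof.
move=> Uy; split; apply: (Ck_on_drv _ Uy).
  exact: (Ck_on_christoffel oU Gunit CG).
exact: (Ck_on_christoffel oU Hunit CH).
Qed.

Lemma drv_conn_diff a l i j y : U y -> drv a (conn_diff l i j) y.
Proof. by move=> Uy; have [dG dH] := drv_christoffel a l i j Uy; exact: drvB. Qed.

(** Both metrics are parallel for their own connections. So the derivative of H - G under the
    connection of [G] is that of [H], and only the difference of the connections acts on it. *)
Lemma covd_diff i j k y : U y -> covd G T [:: i; j; k] y =
  conn_diff_low i j k y + conn_diff_low i k j y.
Proof.
move=> Uy; rewrite covdE2 /=.
have -> : pd i (fun y0 => (H y0 - G y0) j k) y =
    pd i (fun z => H z j k) y - pd i (fun z => G z j k) y.
  under [X in pd i X]eq_fun do rewrite !mxE.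
  by apply: pdB; apply: (Ck_on_drv _ Uy).
rewrite (pd_metric oU Gsym Gunit i j k Uy) (pd_metric oU Hsym Hunit i j k Uy).
rewrite /conn_diff_low /conn_diff.
rewrite !opprD -!sumrN -!big_split /=; apply: eq_bigr => m _.
rewrite !mxE (mx_symE Gsym j m Uy) (mx_symE Hsym j m Uy); ring.
Qed.

Lemma pd_H a m k y : U y -> pd a (fun z => H z m k) y = covd G T [:: a; m; k] y
  + \sum_b christoffel G b a m y * H y b k + \sum_b christoffel G b a k y * H y m b.
Proof.
move=> Uy; rewrite covd_diff// (pd_metric oU Hsym Hunit a m k Uy).
rewrite /conn_diff_low /conn_diff.
rewrite -!big_split /=; apply: eq_bigr => b _.
rewrite (mx_symE Hsym m b Uy); ring.
Qed.

(** Leibniz rule for the contraction of [conn_diff] with [H]: the left side is the covariant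
    derivative of [conn_diff_low], and the last term on the right comes from differentiating [H]. *)
Lemma covd_conn_diff_low a i j k y : U y ->
  pd a (conn_diff_low i j k) y
  - \sum_m christoffel G m a i y * conn_diff_low m j k y
  - \sum_m christoffel G m a j y * conn_diff_low i m k y
  - \sum_m christoffel G m a k y * conn_diff_low i j m y =
  nabla_conn_diff_low a i j k y
  + \sum_m conn_diff m i j y * covd G T [:: a; m; k] y.
Proof.
move=> Uy; rewrite /conn_diff_low pd_sum; last first.
  by move=> m; apply: drvM; [exact: drv_conn_diff|apply: (Ck_on_drv _ Uy)].
have -> : \sum_m pd a (fun z => conn_diff m i j z * H z m k) y =
  \sum_m pd a (conn_diff m i j) y * H y m k +
  \sum_m conn_diff m i j y * covd G T [:: a; m; k] y +
  \sum_m conn_diff m i j y * (\sum_b christoffel G b a m y * H y b k) +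
  \sum_m conn_diff m i j y * (\sum_b christoffel G b a k y * H y m b).
  rewrite -!big_split /=; apply: eq_bigr => m _; rewrite pdM; last 2 first.
  - exact: drv_conn_diff.
  - by apply: (Ck_on_drv _ Uy).
  rewrite pd_H//; ring.
have -> : \sum_m christoffel G m a k y * (\sum_m0 conn_diff m0 i j y * H y m0 m) =
  \sum_m conn_diff m i j y * (\sum_b christoffel G b a k y * H y m b).
  under eq_bigr do rewrite mulr_sumr; under [RHS]eq_bigr do rewrite mulr_sumr.
  rewrite exchange_big /=; apply: eq_bigr => m _; apply: eq_bigr => b _; ring.
(* Moves an inner contraction from one factor to the other, so that all terms become traces against
   the same components of [H]. *)
have E (f : 'I_n -> 'I_n -> R) (g : 'I_n -> R) (p : 'I_n -> R) :
    \sum_m g m * (\sum_b f m b * p b) = \sum_m (\sum_b g b * f b m) * p m.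
  under eq_bigr do rewrite mulr_sumr; under [RHS]eq_bigr do rewrite mulr_suml.
  rewrite exchange_big /=; apply: eq_bigr => m _; apply: eq_bigr => b _; ring.
rewrite (E (fun m b => christoffel G b a m y) (fun m => conn_diff m i j y) (fun b => H y b k)).
rewrite (E (fun m b => conn_diff b m j y) (fun m => christoffel G m a i y) (fun b => H y b k)).
rewrite (E (fun m b => conn_diff b i m y) (fun m => christoffel G m a j y) (fun b => H y b k)).
rewrite /nabla_conn_diff_low /nabla_conn_diff.
have -> : \sum_m (\sum_b conn_diff b i j y * christoffel G m a b y) * H y m k =
  \sum_m (\sum_b christoffel G m a b y * conn_diff b i j y) * H y m k.
  by apply: eq_bigr => m _; congr (_ * _); apply: eq_bigr => b _; rewrite mulrC.
under [X in _ = X + _]eq_bigr do rewrite !mulrDl !mulNr.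
rewrite !big_split /= !sumrN; ring.
Qed.

Lemma covd2_diff a i j k y : U y -> covd G (covd G T) [:: a; i; j; k] y =
  nabla_conn_diff_low a i j k y + nabla_conn_diff_low a i k j y
  + \sum_m conn_diff m i j y * covd G T [:: a; m; k] y
  + \sum_m conn_diff m i k y * covd G T [:: a; m; j] y.
Proof.
move=> Uy; rewrite covdE3.
have -> : pd a (covd G T [:: i; j; k]) y =
    pd a (conn_diff_low i j k) y + pd a (conn_diff_low i k j) y.
  rewrite -pdD; first by apply: near_pd; apply: (near_open oU Uy) => z Uz;
    exact: covd_diff.
  - by apply: drv_sum => m; apply: drvM; [exact: drv_conn_diff|apply: (Ck_on_drv _ Uy)].
  - by apply: drv_sum => m; apply: drvM; [exact: drv_conn_diff|apply: (Ck_on_drv _ Uy)].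
have E1 := covd_conn_diff_low a i j k Uy; have E2 := covd_conn_diff_low a i k j Uy.
under eq_bigr do rewrite covd_diff// mulrDr.
under [X in _ - X - _]eq_bigr do rewrite covd_diff// mulrDr.
under [X in _ - X]eq_bigr do rewrite covd_diff// mulrDr.
rewrite !big_split /= in E1 E2 *; move: E1 E2; lra.
Qed.

(** Substitute the connection of [G] plus A for that of [H] in the curvature: the part linear in A
    combines with the derivatives of A into covariant derivatives, and the part quadratic in A
    remains. *)
Lemma ricci_diff j k y : U y -> ricci H j k y - ricci G j k y =
  \sum_i (nabla_conn_diff i i j k y - nabla_conn_diff j i i k y
    + \sum_m (conn_diff i i m y * conn_diff m j k y
              - conn_diff i j m y * conn_diff m i k y)).
Proof.
move=> Uy; rewrite /ricci -sumrB; apply: eq_bigr => i _.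
rewrite /curvature /nabla_conn_diff.
have pdA a l p q : pd a (conn_diff l p q) y =
    pd a (christoffel H l p q) y - pd a (christoffel G l p q) y.
  by have [dG dH] := drv_christoffel a l p q Uy; rewrite -pdB.
rewrite !pdA.
have -> : \sum_m (christoffel H i i m y * christoffel H m j k y -
          christoffel H i j m y * christoffel H m i k y) =
 \sum_m (christoffel G i i m y * christoffel G m j k y -
          christoffel G i j m y * christoffel G m i k y)
 + \sum_b christoffel G i i b y * conn_diff b j k y
 - \sum_b christoffel G b i j y * conn_diff i b k y
 - \sum_b christoffel G b i k y * conn_diff i j b y
 - \sum_b christoffel G i j b y * conn_diff b i k y
 + \sum_b christoffel G b j i y * conn_diff i b k y
 + \sum_b christoffel G b j k y * conn_diff i i b y
 + \sum_m (conn_diff i i m y * conn_diff m j k y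
              - conn_diff i j m y * conn_diff m i k y).
  rewrite -!sumrN -!big_split /=; apply: eq_bigr => m _.
  (* Torsion-freeness: the terms pairing the lower derivative index of one covariant derivative with
     that of the other cancel. *)
  rewrite (christoffel_sym oU Gsym m j i Uy) /conn_diff.
  have alg (h1 h2 h3 h4 h6 g1 g2 g3 g4 g5 g6 : R) :
    h1 * h2 - h3 * h4 = g1 * g2 - g3 * g4 + g1 * (h2 - g2) - g5 * (h6 - g6)
      - g4 * (h3 - g3) - g3 * (h4 - g4) + g5 * (h6 - g6) + g2 * (h1 - g1)
      + ((h1 - g1) * (h2 - g2) - (h3 - g3) * (h4 - g4)) by ring.
  exact: alg.
have alg (h1 h2 g1 g2 s0 s1 s2 s3 s4 s5 s6 s7 : R) :
    h1 - h2 + (s0 + s1 - s2 - s3 - s4 + s5 + s6 + s7) - (g1 - g2 + s0) =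
    h1 - g1 + s1 - s2 - s3 - (h2 - g2 + s4 - s5 - s6) + s7 by ring.
exact: alg.
Qed.

End MetricDifference.
#[local] Transparent christoffel covd.

(** * Contraction estimates in an orthonormal frame *)

Section Contractions.
Context {R : realType} {n : nat}.
Variables (E : 'M[R]_n).
Implicit Types (a b c d p q i j k l m : 'I_n).

(** [ct] to [ct4] are curried versions of [hat], one per rank: components along the rows of the
    frame matrix [E]. *)
Definition ct a (f : 'I_n -> R) : R := \sum_i E a i * f i.
Definition ct2 (f : 'I_n -> 'I_n -> R) a b : R := ct a (fun i => ct b (f i)).
Definition ct3 (f : 'I_n -> 'I_n -> 'I_n -> R) a b c : R :=
  ct a (fun i => ct2 (f i) b c).
Definition ct4 (f : 'I_n -> 'I_n -> 'I_n -> 'I_n -> R) a b c d : R :=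
  ct a (fun i => ct3 (f i) b c d).

Lemma eq_ct a f g : f =1 g -> ct a f = ct a g.
Proof. by move=> fg; apply: eq_bigr => i _; rewrite fg. Qed.

Lemma ctC a b (f : 'I_n -> 'I_n -> R) :
  ct a (fun i => ct b (fun j => f i j)) = ct b (fun j => ct a (fun i => f i j)).
Proof.
rewrite /ct; under eq_bigr do rewrite mulr_sumr.
under [RHS]eq_bigr do rewrite mulr_sumr.
by rewrite exchange_big /=; do 2 (apply: eq_bigr => ? _); rewrite mulrCA.
Qed.

Lemma ctD a f g : ct a (fun i => f i + g i) = ct a f + ct a g.
Proof. by rewrite /ct -big_split; apply: eq_bigr => i _; rewrite mulrDr. Qed.

Lemma ctN a f : ct a (fun i => - f i) = - ct a f.
Proof. by rewrite /ct -sumrN; apply: eq_bigr => i _; rewrite mulrN. Qed.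

Lemma ctMl a x f : ct a (fun i => x * f i) = x * ct a f.
Proof. by rewrite /ct mulr_sumr; apply: eq_bigr => i _; rewrite mulrCA. Qed.

Lemma ctMr a x f : ct a (fun i => f i * x) = ct a f * x.
Proof. by rewrite /ct mulr_suml; apply: eq_bigr => i _; rewrite mulrA. Qed.

Lemma ct_sum a (F : 'I_n -> 'I_n -> R) :
  ct a (fun i => \sum_k F k i) = \sum_k ct a (F k).
Proof.
by rewrite /ct exchange_big; apply: eq_bigr => i _; rewrite mulr_sumr.
Qed.

Lemma ct_sum2 a (g : 'I_n -> 'I_n -> R) (F : 'I_n -> 'I_n -> 'I_n -> R) :
  ct a (fun i => \sum_k \sum_l g k l * F k l i) =
  \sum_k \sum_l g k l * ct a (F k l).
Proof.
rewrite ct_sum; apply: eq_bigr => k _; rewrite ct_sum; apply: eq_bigr => l _.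
exact: ctMl.
Qed.

Variables S S' : 'M[R]_n.
Hypothesis SE : S = E^T *m S' *m E.

(** [S] and [S'] are one bilinear form on covectors, in coordinates and in the frame; its trace is
    the same in both. All coordinate traces are moved to the frame in this way, where the components
    are bounded. *)
Lemma trace_frame (f : 'I_n -> 'I_n -> R) :
  \sum_m \sum_l S m l * f m l = \sum_p \sum_q S' p q * ct2 f p q.
Proof.
have E1 m l : S m l = \sum_p \sum_q S' p q * (E p m * E q l).
  rewrite SE mxE exchange_big; apply: eq_bigr => p _ /=.
  rewrite mxE mulr_suml; apply: eq_bigr => q _; rewrite !mxE; ring.
under eq_bigr do (under eq_bigr do rewrite E1 mulr_suml).
under eq_bigr do rewrite exchange_big /=.
rewrite exchange_big /=; apply: eq_bigr => p _.
under eq_bigr do (under eq_bigr do rewrite mulr_suml).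
under eq_bigr do rewrite exchange_big /=.
rewrite exchange_big /=; apply: eq_bigr => q _.
rewrite /ct2 /ct mulr_sumr; apply: eq_bigr => m _.
rewrite !mulr_sumr; apply: eq_bigr => l _; ring.
Qed.

Lemma sum2_le (s f : 'I_n -> 'I_n -> R) (x y : R) :
  (forall p q, `|s p q| <= x) -> (forall p q, `|f p q| <= y) ->
  `|\sum_p \sum_q s p q * f p q| <= n%:R ^+ 2 * (x * y).
Proof.
move=> sx fy; apply: le_trans (ler_norm_sum _ _ _) _.
apply: (@le_trans _ _ (\sum_(p < n) \sum_(q < n) x * y)); last first.
  by rewrite !sumr_const !card_ord -mulrnA -natrX mulr_natl mulnn.
apply: ler_sum => p _; apply: le_trans (ler_norm_sum _ _ _) _.
by apply: ler_sum => q _; rewrite normrM; apply: ler_pM.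
Qed.

(* With S = H^-1: [al] is the difference of the Levi-Civita connections of H and
   G and [B] its covariant derivative, both with the last index lowered by H,
   while [T1] and [T2] are the first and second covariant derivatives of H - G. *)
Variables (al T1 : 'I_n -> 'I_n -> 'I_n -> R).
Variables (B T2 : 'I_n -> 'I_n -> 'I_n -> 'I_n -> R).
Let A m i j := \sum_l S m l * al i j l.
Let DA a m i j := \sum_l S m l * B a i j l.
Hypothesis al_sym : forall i j k, al i j k = al j i k.
Hypothesis T1E : forall i j k, T1 i j k = al i j k + al i k j.
Hypothesis B_sym : forall a i j k, B a i j k = B a j i k.
Hypothesis T2E : forall a i j k, T2 a i j k = B a i j k + B a i k j
  + \sum_m A m i j * T1 a m k + \sum_m A m i k * T1 a m j.
Variable r : R.
Hypothesis r1 : r <= 1.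
Hypothesis T1r : forall a b c, `|ct3 T1 a b c| <= r.
Hypothesis T2r : forall a b c d, `|ct4 T2 a b c d| <= r.
Hypothesis S'2 : forall p q, `|S' p q| <= 2.

(** Koszul's trick: [T1] symmetrises [al] in its last two slots while [al] is symmetric in its first
    two, so an alternating sum of three permutations of [T1] is twice [al]. This gives 3/2 r,
    rounded up to 2 r. *)
Lemma ct3_al a b c : `|ct3 al a b c| <= 2 * r.
Proof.
have h x y z : ct3 T1 x y z = ct3 al x y z + ct3 al x z y.
  rewrite /ct3 /ct2.
  under eq_ct do (under eq_ct do (under eq_ct do rewrite T1E)).
  under eq_ct do (under eq_ct do rewrite ctD).
  under eq_ct do rewrite ctD [X in _ + X]ctC.
  by rewrite ctD.
have s x y z : ct3 al x y z = ct3 al y x z.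
  rewrite /ct3 /ct2 ctC.
  by do 3 (apply: eq_ct => ?); rewrite al_sym.
have -> : ct3 al a b c = 2^-1 * (ct3 T1 a b c + ct3 T1 b a c - ct3 T1 c a b).
  rewrite !h (s b a c) (s c a b) (s c b a); lra.
move: (T1r a b c) (T1r b a c) (T1r c a b); rewrite !ler_norml; lra.
Qed.

Let K a i j k := \sum_m A m i j * T1 a m k.

(** [K] is the correction in [T2E], a trace of [al] against [T1]. The factors 2, 2 r and r bound
    [S'], [al] and [T1]. *)
Lemma ct4_K a b c d : `|ct4 K a b c d| <= n%:R ^+ 2 * (2 * (2 * r * r)).
Proof.
have KE a' i j k : K a' i j k =
    \sum_p \sum_q S' p q * (ct q (al i j) * ct p (fun m => T1 a' m k)).
  transitivity (\sum_m \sum_l S m l * (al i j l * T1 a' m k)).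
    apply: eq_bigr => m _; rewrite /A mulr_suml; apply: eq_bigr => l _.
    by rewrite mulrA.
  rewrite trace_frame; do 2 (apply: eq_bigr => ? _); congr (_ * _).
  by rewrite /ct2 mulrC -ctMr; apply: eq_ct => m; rewrite ctMr mulrC.
have -> : ct4 K a b c d =
    \sum_p \sum_q S' p q * (ct3 al b c q * ct3 T1 a p d).
  (* The four contractions are pushed through the trace from the innermost slot outwards. *)
  rewrite /ct4 /ct3 /ct2.
  under eq_ct do (under eq_ct do (under eq_ct do (under eq_ct do rewrite KE;
    rewrite ct_sum2))).
  under eq_ct do (under eq_ct do (under eq_ct do (under eq_bigr do (under eq_bigr
    do rewrite ctMl)); rewrite ct_sum2)).
  under eq_ct do (under eq_ct do (under eq_bigr do (under eq_bigr
    do rewrite ctMr)); rewrite ct_sum2).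
  under eq_ct do (under eq_bigr do (under eq_bigr do rewrite ctMr)).
  rewrite ct_sum2; do 2 (apply: eq_bigr => ? _); congr (_ * _).
  by rewrite ctMl; congr (_ * _); apply: eq_ct => i; rewrite ctC.
apply: sum2_le => // p q; rewrite normrM; apply: ler_pM => //; exact: ct3_al.
Qed.

Let N : R := n%:R ^+ 2.

(** The same inversion as for [al], in the last three slots, once the corrections [K] have been
    moved to the side of [T2]. As r <= 1, each correction is at most 4 N r, so [W] is at most (1 + 8
    N) r and half of three such terms is below (2 + 16 N) r. *)
Lemma ct4_B a b c d : `|ct4 B a b c d| <= (2 + 16 * N) * r.
Proof.
have h x y z w : ct4 T2 x y z w =
    ct4 B x y z w + ct4 B x y w z + ct4 K x y z w + ct4 K x y w z.
  rewrite /ct4 /ct3 /ct2.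
  under eq_ct do (under eq_ct do (under eq_ct do (under eq_ct do
    rewrite T2E -/(K _ _ _ _) -/(K _ _ _ _)))).
  under eq_ct do (under eq_ct do (under eq_ct do rewrite !ctD)).
  under eq_ct do (under eq_ct do (rewrite !ctD [X in _ + X + _ + _]ctC
    [X in _ + X]ctC)).
  under eq_ct do rewrite !ctD.
  by rewrite !ctD.
have s x y z w : ct4 B x y z w = ct4 B x z y w.
  rewrite /ct4 /ct3 /ct2; apply: eq_ct => i; rewrite ctC.
  by do 3 (apply: eq_ct => ?); rewrite B_sym.
pose W x y z w := ct4 T2 x y z w - ct4 K x y z w - ct4 K x y w z.
have r0 : 0 <= r by apply: le_trans (normr_ge0 _) (T1r a a a).
have Wr x y z w : `|W x y z w| <= (1 + 8 * N) * r.
  have N0 : 0 <= N by exact: sqr_ge0.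
  have : N * (2 * (2 * r * r)) <= 4 * N * r.
    have := ler_wpM2l (mulr_ge0 N0 r0) r1; lra.
  move: (T2r x y z w) (ct4_K x y z w) (ct4_K x y w z).
  rewrite -/N /W !ler_norml; lra.
have -> : ct4 B a b c d = 2^-1 * (W a b c d + W a c b d - W a d b c).
  rewrite /W !h (s a c b d) (s a d b c) (s a d c b); lra.
move: (Wr a b c d) (Wr a c b d) (Wr a d b c); rewrite !ler_norml.
have : 0 <= N * r by rewrite mulr_ge0// sqr_ge0.
lra.
Qed.

(** With indices lowered, the change of Ricci is the trace of a 4-tensor. Its frame components are
    at most (4 + 48 N) r: twice the bound for [B], plus 16 N r for the quadratic part. The two
    nested traces against [S'] contribute a factor 2 N each. *)
Lemma scalar_diff_le :
  `|\sum_j \sum_k S j k * \sum_i (DA i i j k - DA j i i k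
     + \sum_m (A i i m * A m j k - A i j m * A m i k))|
  <= N * (2 * (N * (2 * ((4 + 48 * N) * r)))).
Proof.
(* [Y] collects the products of two connection differences, and [X] is the full 4-tensor whose trace
   over [i] and [l] is the change of Ricci. *)
pose Y j k i l := \sum_m \sum_p S m p * (al i m l * al j k p - al j m l * al i k p).
pose X j k i l := B i j k l - B j i k l + Y j k i l.
have E1 j k : \sum_i (DA i i j k - DA j i i k
     + \sum_m (A i i m * A m j k - A i j m * A m i k)) =
   \sum_i \sum_l S i l * X j k i l.
  apply: eq_bigr => i _.
  have -> : \sum_m (A i i m * A m j k - A i j m * A m i k) =
      \sum_l S i l * Y j k i l.
    transitivity (\sum_m \sum_l S i l * \sum_p S m p *
        (al i m l * al j k p - al j m l * al i k p)).
      apply: eq_bigr => m _; rewrite /A !mulr_suml -sumrB.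
      apply: eq_bigr => l _; rewrite !mulr_sumr -sumrB.
      apply: eq_bigr => p _; ring.
    rewrite exchange_big; apply: eq_bigr => l _ /=; rewrite /Y mulr_sumr.
    by [].
  rewrite /DA -sumrB -big_split; apply: eq_bigr => l _; rewrite /X /=; ring.
under eq_bigr do (under eq_bigr do rewrite E1 trace_frame).
rewrite trace_frame; apply: sum2_le => // a b.
rewrite /ct2; under eq_ct do rewrite ct_sum2.
rewrite ct_sum2; apply: sum2_le => // c d.
rewrite -/(ct4 X a b c d) /X.
have YE j k i l : Y j k i l = \sum_e \sum_f S' e f *
   (ct e (fun m => al i m l) * ct f (al j k) - ct e (fun m => al j m l) * ct f (al i k)).
  rewrite /Y trace_frame; do 2 (apply: eq_bigr => ? _); congr (_ * _).
  rewrite /ct2 -!ctMr -ctN -ctD; apply: eq_ct => m.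
  by rewrite ctD ctN !ctMl.
have -> : ct4 (fun j k i l => B i j k l - B j i k l + Y j k i l) a b c d =
   ct4 B c a b d - ct4 B a c b d + ct4 Y a b c d.
  rewrite /ct4 /ct3 /ct2.
  under eq_ct do (under eq_ct do (under eq_ct do rewrite ctD ctD ctN)).
  under eq_ct do (under eq_ct do rewrite ctD ctD ctN).
  under eq_ct do rewrite ctD ctD ctN ctC [X in _ - X + _]ctC.
  by rewrite ctD ctD ctN ctC.
have -> : ct4 Y a b c d = \sum_e \sum_f S' e f *
   (ct3 al c e d * ct3 al a b f - ct3 al a e d * ct3 al c b f).
  rewrite /ct4 /ct3 /ct2.
  under eq_ct do (under eq_ct do (under eq_ct do (under eq_ct do rewrite YE;
    rewrite ct_sum2))).
  under eq_ct do (under eq_ct do (under eq_ct do (under eq_bigr do (under eq_bigr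
    do rewrite ctD ctN !ctMr)); rewrite ct_sum2)).
  under eq_ct do (under eq_ct do (under eq_bigr do (under eq_bigr
    do rewrite ctD ctN ctMr ctMl)); rewrite ct_sum2).
  under eq_ct do (under eq_bigr do (under eq_bigr do rewrite ctD ctN ctMl ctMl)).
  rewrite ct_sum2; do 2 (apply: eq_bigr => ? _); congr (_ * _).
  rewrite ctD ctN ctMl ctMr; congr (_ * _ - _ * _).
  - by apply: eq_ct => i; rewrite ctC.
  - by apply: eq_ct => i; rewrite ctC.
  - exact: ctC.
have r0 : 0 <= r by apply: le_trans (normr_ge0 _) (T1r a a a).
have N0 : 0 <= N by exact: sqr_ge0.
have : `|\sum_e \sum_f S' e f *
   (ct3 al c e d * ct3 al a b f - ct3 al a e d * ct3 al c b f)| <= N * (2 * (8 * r)).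
  apply: sum2_le => // e f; apply: le_trans (ler_normB _ _) _.
  have P x1 y1 z1 x2 y2 z2 : `|ct3 al x1 y1 z1 * ct3 al x2 y2 z2| <= 4 * r.
    rewrite normrM; apply: (@le_trans _ _ (2 * r * (2 * r))).
      by apply: ler_pM => //; exact: ct3_al.
    have := ler_wpM2l r0 r1; lra.
  by apply: le_trans (lerD (P c e d a b f) (P a e d c b f)) _; lra.
move: (ct4_B c a b d) (ct4_B a c b d); rewrite !ler_norml; lra.
Qed.

End Contractions.

(** * Pointwise perturbation of a metric *)

Lemma Ck_on0 {R : realType} {n : nat} (U : set 'rV[R]_n) f :
  (forall y, U y -> {for y, continuous f}) -> Ck_on 0 U f.
Proof. by []. Qed.

(** Continuity of the determinant and of the inverse at the identity. Matrices are read as vectors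
    of length n * n so that the order 0 case of the C^k calculus applies. *)
Lemma near_identity {R : realType} (n : nat) (e : R) : 0 < e ->
  exists2 r : R, 0 < r & forall X : 'M[R]_n, (forall a b, `|X a b| < r) ->
    [/\ `|\det (1%:M + X) - 1| <= e,
        1%:M + X \in unitmx &
        forall a b, `|invmx (1%:M + X) a b - (1%:M : 'M[R]_n) a b| <= e].
Proof.
move=> e0; pose A (y : 'rV[R]_(n * n)) : 'M[R]_n := 1%:M + vec_mx y.
have CA U : open U -> forall i j, Ck_on 0 U (fun z => A z i j).
  move=> oU i j; under eq_fun do rewrite mxE.
  apply: Ck_onD => //; first exact: Ck_on_cst.
  have -> : (fun z : 'rV[R]_(n * n) => vec_mx z i j) =
      fun z : 'rV[R]_(n * n) => z ord0 (mxvec_index i j).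
    by apply/funext => z; rewrite mxE.
  by apply: Ck_on0 => y _; exact: coord_continuous.
have Cdet : Ck_on 0 setT (fun z => \det (A z)).
  by apply: Ck_on_det; [exact: openT|exact/CA/openT].
pose U := [set y | \det (A y) != 0].
have oU : open U.
  apply: (@open_comp _ _ (fun z => \det (A z)) [set x | x != 0]).
    by move=> y _; exact: (Ck_on_cont Cdet).
  exact: open_neq.
have uA y : U y -> A y \in unitmx by rewrite unitmxE unitfE.
have CI := Ck_on_invmx oU uA (CA _ oU).
have A0 : A 0 = 1%:M by rewrite /A linear0 addr0.
have U0 : U 0 by rewrite /U /= A0 det1 oner_eq0.
have n1 : \forall y \near (0 : 'rV[R]_(n * n)), `|\det (A y) - 1| <= e.
  have : (fun z => \det (A z)) @ (0 : 'rV[R]_(n * n)) --> \det (A 0).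
    exact: (Ck_on_cont Cdet I).
  rewrite A0 det1 => /cvgrPdist_le/(_ e e0); apply: filterS => y; by rewrite distrC.
have n2 : \forall y \near (0 : 'rV[R]_(n * n)),
    forall a b, `|invmx (A y) a b - (1%:M : 'M[R]_n) a b| <= e.
  suff h a b : \forall y \near (0 : 'rV[R]_(n * n)),
    `|invmx (A y) a b - (1%:M : 'M[R]_n) a b| <= e.
    have h2 a := filter_forall (nbhs_filter (0 : 'rV[R]_(n * n))) (h a).
    exact: (filter_forall (nbhs_filter (0 : 'rV[R]_(n * n))) h2).
  have : (fun z => invmx (A z) a b) @ (0 : 'rV[R]_(n * n)) --> invmx (A 0) a b.
    exact: (Ck_on_cont (CI a b) U0).
  rewrite A0 invmx1 => /cvgrPdist_le/(_ e e0); apply: filterS => y; by rewrite distrC.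
have n3 : \forall y \near (0 : 'rV[R]_(n * n)), U y.
  by apply: open_nbhs_nbhs; split.
have : nbhs (0 : 'rV[R]_(n * n)) [set y | U y /\ `|\det (A y) - 1| <= e /\
    forall a b, `|invmx (A y) a b - (1%:M : 'M[R]_n) a b| <= e].
  by apply: filterI => //; exact: filterI.
move=> /nbhs_ballP[r /= r0 br].
exists r => // X Xr.
have AX : A (mxvec X) = 1%:M + X by rewrite /A mxvecK.
rewrite -AX; have [|/= h1 [h2 h3]] := br (mxvec X).
  split => // i k; rewrite ord1; case/mxvec_indexP: k => a b.
  by rewrite mxvecE mxE /ball /= sub0r normrN.
by split => //; exact: uA.
Qed.
Lemma sum_mul_invmx {R : fieldType} n (A : 'M[R]_n) (f : 'I_n -> R) m :
  A \in unitmx -> A^T = A ->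
  \sum_l invmx A m l * (\sum_k f k * A k l) = f m.
Proof.
move=> uA sA; under eq_bigr do rewrite mulr_sumr; rewrite exchange_big /=.
transitivity (\sum_k f k * (invmx A *m A) m k).
  apply: eq_bigr => k _; rewrite mxE mulr_sumr; apply: eq_bigr => l _.
  by rewrite -{2}sA mxE; ring.
rewrite mulVmx// (bigD1 m)//= mxE eqxx mulr1 big1 ?addr0// => k km.
by rewrite mxE eq_sym (negbTE km) mulr0.
Qed.

Lemma sqrt_le_mulr {R : realType} (x y k : R) : 0 <= k -> x <= k ^+ 2 * y ->
  Num.sqrt x <= k * Num.sqrt y.
Proof.
move=> k0 xy; rewrite -[X in X * _](ger0_norm k0) -sqrtr_sqr -sqrtrM ?sqr_ge0//.
exact: ler_wsqrtr.
Qed.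

(** The radius is chosen before the domain, the metrics and the point, hence depends on [n] and [e]
    only; this uniformity lets the estimate hold on all of a noncompact manifold at once. *)
Lemma metric_perturbation {R : realType} (n : nat) (e : R) : 0 < e ->
  exists2 r : R, 0 < r & forall U (G H : 'rV[R]_n -> 'M[R]_n) (y : 'rV[R]_n),
  open U -> U y ->
  (forall y, U y -> (G y)^T = G y) -> (forall y, U y -> posdef (G y)) ->
  (forall y, U y -> (H y)^T = H y) -> (forall y, U y -> posdef (H y)) ->
  (forall i j, Ck_on 2 U (fun z => G z i j)) ->
  (forall i j, Ck_on 2 U (fun z => H z i j)) ->
  (forall i : 'I_3, tensor_norm (G y) (i + 2) (fun I =>
     iter i (covd G) (mxtensor (fun z => H z - G z)) I y) < r) ->
  [/\ Num.sqrt (\det (H y)) <= (1 + e) * Num.sqrt (\det (G y)),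
      Num.sqrt (\det (G y)) <= (1 + e) * Num.sqrt (\det (H y)),
      forall T, `|tensor_norm (H y) 1 T ^+ 2 - tensor_norm (G y) 1 T ^+ 2|
        <= e * tensor_norm (G y) 1 T ^+ 2 &
      `|scalar_curvature H y - scalar_curvature G y| <=
        e * (1 + tensor_norm (G y) 2 (fun I =>
           mxtensor (fun z => \matrix_(i, j) ricci G i j z) I y))].
Proof.
move=> e0; pose N : R := n%:R ^+ 2.
have N0 : 0 <= N by exact: sqr_ge0.
(* This tolerance gives x N <= e for traces over n^2 components, and x (1 + 2 e) <= e, whence (1 +
   e)^2 (1 - x) >= 1 for the second density bound. *)
pose x := e / ((1 + 2 * e) * (1 + N)).
have d0 : 0 < (1 + 2 * e) * (1 + N) by rewrite mulr_gt0//; lra.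
have x0 : 0 < x by rewrite divr_gt0.
have xd : x * ((1 + 2 * e) * (1 + N)) = e by rewrite divfK// gt_eqF.
have xe : 0 <= x * e by rewrite mulr_ge0 ?ltW.
have xN : 0 <= x * N by rewrite mulr_ge0 // ltW.
have xeN : 0 <= x * e * N by rewrite mulr_ge0.
have x2 : x <= 1 / 2.
  rewrite ler_pdivrMr//; have : 0 <= e * N by rewrite mulr_ge0// ltW.
  lra.
have [r1 r10 r1P] := near_identity n x0.
pose C := N * (2 * (N * (2 * (4 + 48 * N)))).
have C0 : 0 <= C.
  by rewrite !mulr_ge0//; rewrite addr_ge0// mulr_ge0.
(* The three bounds serve [near_identity], the absorption of quadratic terms (r <= 1), and C r <= e
   for the constant [C] of [scalar_diff_le]. *)
pose r := Num.min r1 (Num.min 1 (e / (C + 1))).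
have rr1 : r <= r1 by rewrite ge_min lexx.
have r1' : r <= 1 by rewrite !ge_min lexx orbT.
have rC : C * r <= e.
  have : r <= e / (C + 1) by rewrite !ge_min lexx !orbT.
  rewrite ler_pdivlMr; last lra.
  have : 0 < r; last lra.
  rewrite !lt_min r10 ltr01 divr_gt0//; lra.
exists r.
  by rewrite !lt_min r10 ltr01 divr_gt0//; lra.
move=> U G H y oU Uy sG pG sH pH CG CH Tr.
have uG z : U z -> G z \in unitmx by move=> Uz; exact: posdef_unit (sG z Uz) (pG z Uz).
have uH z : U z -> H z \in unitmx by move=> Uz; exact: posdef_unit (sH z Uz) (pH z Uz).
pose E := frame (G y); pose S := invmx (H y).
have [sGy pGy] := (sG y Uy, pG y Uy).
have uE : E \in unitmx := frame_unit sGy pGy.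
have hT (s : seq 'I_n) (i : 'I_3) : size s = (i + 2)%N ->
    `|hat E s (fun I => iter i (covd G) (mxtensor (fun z => H z - G z)) I y)| < r.
  by move=> si; apply: le_lt_trans (Tr i); rewrite -si; exact: hat_le_tensor_norm.
(* In the orthonormal frame of [G] the metric [H] is the identity plus [X], and the entries of [X]
   are bounded by the order 0 part of the norm. *)
pose X := E *m (H y - G y) *m E^T.
have EHE : E *m H y *m E^T = 1%:M + X.
  by rewrite /X mulmxBr mulmxBl (frameP sGy pGy) addrC subrK.
have Xr a b : `|X a b| < r1.
  apply: lt_le_trans rr1; have := hT [:: a; b] ord0 erefl => /=.
  suff -> : \sum_i E a i * \sum_j E b j * (H y - G y) i j = X a b by [].
  rewrite /X mxE; under [RHS]eq_bigr do rewrite mxE mulr_suml.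
  rewrite exchange_big /=; apply: eq_bigr => i _; rewrite mulr_sumr.
  by apply: eq_bigr => j _; rewrite !mxE; ring.
have [detX uX invX] := r1P X Xr.
pose S' := invmx (1%:M + X).
have SE : S = E^T *m S' *m E.
  rewrite /S' -EHE /S; have uHy := uH y Uy.
  have uET : E^T \in unitmx by rewrite unitmx_tr.
  have -> : invmx (E *m H y *m E^T) = invmx E^T *m invmx (H y) *m invmx E.
    rewrite -[LHS]mul1mx; apply: (canLR (mulmxK _)); last first.
      by rewrite -!mulmxA mulKmx// mulKmx// mulVmx.
    by rewrite EHE.
  by rewrite !mulmxA mulmxV// mul1mx mulmxKV.
have SP : S - invmx (G y) = E^T *m (S' - 1%:M) *m E.
  by rewrite SE (frame_inv sGy pGy) mulmxBr mulmxBl mulmx1.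
have S'1 a b : `|(S' - 1%:M) a b| <= x by rewrite !mxE; have := invX a b; rewrite !mxE.
have S'2 a b : `|S' a b| <= 2.
  have -> : S' a b = (S' - 1%:M) a b + (1%:M : 'M[R]_n) a b by rewrite !mxE subrK.
  apply: le_trans (ler_normD _ _) _.
  have : `|(1%:M : 'M[R]_n) a b| <= 1.
    by rewrite mxE; case: (a == b); rewrite ?normr1// normr0.
  have := S'1 a b; lra.
have detH : \det (H y) = \det (G y) * \det (1%:M + X).
  rewrite -EHE !det_mulmx det_tr -[LHS]mul1r -(frame_det sGy pGy); ring.
have detG := posdef_det sGy pGy.
move: detX; rewrite ler_norml => /andP[detX1 detX2].
split.
- apply: sqrt_le_mulr; first lra.
  rewrite detH mulrC ler_pM2r//.
  have := sqr_ge0 e; lra.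
- apply: sqrt_le_mulr; first lra.
  rewrite detH mulrCA ler_pMr//.
  apply: (@le_trans _ _ ((1 + e) ^+ 2 * (1 - x))).
    have ee : 0 <= e * e by rewrite mulr_ge0 ?ltW.
    have h : 0 <= e * e * (1 - 2 * x) by rewrite mulr_ge0//; lra.
    have h2 : 0 <= x * e * (1 - 2 * x) by rewrite mulr_ge0//; lra.
    have h3 : x * (1 + 2 * e) <= e by lra.
    have h4 : 0 <= e * e * (1 - x) by rewrite mulr_ge0//; lra.
    lra.
  by rewrite ler_wpM2l ?sqr_ge0//; lra.
- move=> T; rewrite !tensor_norm1_sqr//; [|exact: sH|exact: pH].
  have -> : \sum_i \sum_j invmx (H y) i j * (T [:: i] * T [:: j]) -
     \sum_i \sum_j invmx (G y) i j * (T [:: i] * T [:: j]) =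
     \sum_i \sum_j (S - invmx (G y)) i j * (T [:: i] * T [:: j]).
    rewrite -sumrB; apply: eq_bigr => i _; rewrite -sumrB; apply: eq_bigr => j _.
    by rewrite /S !mxE mulrBl.
  rewrite -tensor_norm1_sqr// (trace_frame SP).
  set t := tensor_norm _ _ _.
  apply: (@le_trans _ _ (N * (x * t ^+ 2))).
    apply: sum2_le => // p q.
    have -> : ct2 E (fun i j => T [:: i] * T [:: j]) p q =
        hat E [:: p] T * hat E [:: q] T.
      by rewrite /ct2 /= -ctMr; apply: eq_ct => i; rewrite -ctMl.
    rewrite normrM expr2; apply: ler_pM => //; exact: hat_le_tensor_norm.
  by rewrite mulrA ler_wpM2r ?sqr_ge0//; lra.
- set t := tensor_norm _ _ _.
  have t0 : 0 <= t by exact: tensor_norm_ge0.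
  pose A m i j := conn_diff G H m i j y.
  pose DA a m i j := nabla_conn_diff G H a m i j y.
  (* The change of the inverse metric is paired with the Ricci tensor of [G], giving the term e t;
     the change of Ricci is traced with the inverse of [H], giving the term e. *)
  have -> : scalar_curvature H y - scalar_curvature G y =
    \sum_j \sum_k (S - invmx (G y)) j k * ricci G j k y +
    \sum_j \sum_k S j k * \sum_i (DA i i j k - DA j i i k
     + \sum_m (A i i m * A m j k - A i j m * A m i k)).
    rewrite /scalar_curvature -sumrB -big_split; apply: eq_bigr => j _ /=.
    rewrite -sumrB -big_split; apply: eq_bigr => k _ /=.
    rewrite -(ricci_diff oU sG uG uH CG CH)// !mxE -/S; ring.
  apply: le_trans (ler_normD _ _) _; rewrite mulrDr mulr1 addrC; apply: lerD.
    have AE m i j : A m i j = \sum_l S m l * conn_diff_low G H i j l y.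
      by rewrite /S sum_mul_invmx// ?uH// sH.
    have DAE a m i j : DA a m i j = \sum_l S m l * nabla_conn_diff_low G H a i j l y.
      by rewrite /S sum_mul_invmx// ?uH// sH.
    pose T := mxtensor (fun z => H z - G z).
    have := @scalar_diff_le _ _ E S S' SE
      (fun i j k => conn_diff_low G H i j k y)
      (fun i j k => covd G T [:: i; j; k] y)
      (fun a i j k => nabla_conn_diff_low G H a i j k y)
      (fun a i j k => covd G (covd G T) [:: a; i; j; k] y)
      _ _ _ _ r r1' _ _ S'2.
    rewrite (_ : n%:R ^+ 2 * _ = C * r); last by rewrite /C /N; ring.
    move=> /(_ (fun i j k => conn_diff_low_sym oU sG sH i j k Uy)).
    move=> /(_ (fun i j k => covd_diff oU sG uG sH uH CG CH i j k Uy)).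
    move=> /(_ (fun a i j k => nabla_conn_diff_low_sym oU sG sH a i j k Uy)).
    move=> h; apply: le_trans rC; move: h.
    under eq_bigr do (under eq_bigr do (under eq_bigr do rewrite -!DAE)).
    under eq_bigr do (under eq_bigr do (under eq_bigr do
      (under eq_bigr do rewrite -!AE))).
    apply.
    + move=> a i j k; rewrite (covd2_diff oU sG uG sH uH CG CH)//.
      by congr (_ + _ + _); apply: eq_bigr => m _; rewrite -AE.
    + by move=> a b c; apply: ltW; exact: (hT [:: a; b; c] (@Ordinal 3 1 isT) erefl).
    + by move=> a b c d; apply: ltW; exact: (hT [:: a; b; c; d] (@Ordinal 3 2 isT) erefl).
  rewrite (trace_frame SP); apply: (@le_trans _ _ (N * (x * t))).
    apply: sum2_le => // p q.
    have -> : ct2 E (fun i j => ricci G i j y) p q =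
       hat E [:: p; q] (fun I => mxtensor (fun z => \matrix_(i, j) ricci G i j z) I y).
      by rewrite /ct2 /=; do 2 (apply: eq_ct => ?); rewrite mxE.
    exact: hat_le_tensor_norm.
  by rewrite mulrA ler_wpM2r//; lra.
Qed.

(** * Lebesgue measure on R^n *)

Lemma open_borel (T : ptopologicalType) (A : set T) : open A ->
  measurable (A : set (borel T)).
Proof. by move=> oA; exact: sub_sigma_algebra. Qed.

Section BorelBalls.
Context {R : realType} {n : nat}.

Definition rat_ball (p : 'rV[rat]_n * nat) : set 'rV[R]_n :=
  ball (map_mx ratr p.1 : 'rV[R]_n) p.2.+1%:R^-1.

(** The index type is countable, which makes preimages of open sets accessible to a product
    sigma-algebra. Balls not contained in [A] are replaced by the empty set. *)
Lemma open_rat_balls (A : set 'rV[R]_n) : open A ->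
  A = \bigcup_p (if `[< rat_ball p `<=` A >] then rat_ball p else set0).
Proof.
move=> oA; apply/seteqP; split => [y Ay|y [p _]]; last first.
  by case: asboolP => // h; exact: h.
have /nbhs_ballP[e /= e0 be] : nbhs y A by exact: open_nbhs_nbhs.
(* The radius 1/(k+1) is below e/2, so a ball of this radius that contains y stays inside the ball
   of radius e around y. *)
have [k _ kP] := near_infty_natSinv_lt (PosNum (divr_gt0 e0 (ltr0Sn R 1))).
have {}kP := kP k (leqnn k); rewrite /= in kP.
have k0 : 0 < k.+1%:R^-1 :> R by rewrite invr_gt0 ltr0Sn.
have /choice[q qP] (i : 'I_n) :
    exists q : rat, ball (ratr q : R) k.+1%:R^-1 (y ord0 i).
  move: k0; set r := k.+1%:R^-1 => r0.
  have /rat_in_itvoo[q] : y ord0 i - r < y ord0 i + r by lra.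
  rewrite in_itv /= => /andP[q1 q2]; exists q.
  by rewrite /ball /= ltr_distl; apply/andP; split; lra.
exists (\row_i q i, k) => //.
have By : rat_ball (\row_i q i, k) y.
  by split => // i j; rewrite !mxE ord1; exact: qP.
case: asboolP => // h; exfalso; apply: h => z [_ Bz]; apply: be; split => // i j.
have [_ /(_ i j) Bz'] := By; have := Bz i j; move: Bz'; rewrite /ball /=.
move=> h1 h2; rewrite [e]splitr.
apply: le_lt_trans (ler_distD (map_mx ratr (\row_i q i) i j) _ _) _.
by rewrite distrC ltrD// (lt_trans _ kP).
Qed.

End BorelBalls.

Section RowMx.
Context {R : realType} {n : nat}.

Definition cons_rV (p : measurableTypeR R * borel 'rV[R]_n) :
  borel 'rV[R]_n.+1 := row_mx (p.1%:M : 'M[R]_1) (p.2 : 'rV[R]_n).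

Lemma cons_rV0 p : cons_rV p ord0 ord0 = p.1.
Proof.
have -> : ord0 = @lshift 1 n ord0 by exact: val_inj.
by apply: etrans (row_mxEl _ _ _ _) _; rewrite mxE.
Qed.

Lemma cons_rVS p j : cons_rV p ord0 (lift ord0 j) = p.2 ord0 j.
Proof.
have -> : lift ord0 j = @rshift 1 n j by exact: val_inj.
exact: row_mxEr.
Qed.

Lemma cons_rV_ball (c : 'rV[R]_n.+1) (e : R) :
  cons_rV @^-1` (ball c e) =
  ball (c ord0 ord0) e `*` ball (\row_j c ord0 (lift ord0 j)) e.
Proof.
apply/seteqP; split => [[t y] [e0 /= h]|[t y] [/= ht [e0 h]]].
  split => /=; first by have := h ord0 ord0; rewrite cons_rV0.
  split => // i j; have := h i (lift ord0 j); rewrite (ord1 i) cons_rVS.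
  by rewrite mxE.
split => // i j; rewrite (ord1 i); have [k ->|->] := unliftP ord0 j.
  by rewrite cons_rVS; have := h ord0 k; rewrite mxE.
by rewrite cons_rV0.
Qed.

(** Balls of row vectors are sup-norm balls, so their preimages are products of balls; countable
    unions of these give all open sets. *)
Lemma measurable_cons_rV : measurable_fun setT cons_rV.
Proof.
have := @measurability _ _ (measurableTypeR R * borel 'rV[R]_n)%type (borel 'rV[R]_n.+1)
  setT cons_rV (@open 'rV[R]_n.+1).
apply=> // _ [A oA <-]; rewrite setTI.
rewrite (open_rat_balls oA) preimage_bigcup.
apply: countable_bigcupT_measurable => // p; case: asboolP => _; last first.
  by rewrite preimage_set0.
rewrite /rat_ball cons_rV_ball; apply: measurableX.
  by rewrite ball_itv; exact: measurable_itv.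
by apply: open_borel; exact: ball_open.
Qed.

End RowMx.

Section LebesgueCons.
Context {R : realType} {n : nat}.
Variable mu : {sigma_finite_measure set (borel 'rV[R]_n) -> \bar R}.

Definition lebesgue_cons (A : set (borel 'rV[R]_n.+1)) : \bar R :=
  product_measure1 (@lebesgue_measure R) mu (cons_rV @^-1` A).

Let lebesgue_cons0 : lebesgue_cons set0 = 0%E.
Proof. by rewrite /lebesgue_cons preimage_set0 measure0. Qed.

Let lebesgue_cons_ge0 A : (0 <= lebesgue_cons A)%E.
Proof. exact: measure_ge0. Qed.

Let lebesgue_cons_sigma_additive : semi_sigma_additive lebesgue_cons.
Proof.
move=> F mF tF mUF; rewrite /lebesgue_cons preimage_bigcup.
have mp A : measurable A -> measurable (@cons_rV R n @^-1` A).
  by move=> mA; rewrite -[X in measurable X]setTI; exact: measurable_cons_rV.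
apply: measure_semi_sigma_additive.
- by move=> k; exact: mp.
- apply/trivIsetP => i j _ _ ij; rewrite -preimage_setI.
  by move/trivIsetP : tF => /(_ i j I I ij) ->; rewrite preimage_set0.
- by rewrite -preimage_bigcup; exact: mp.
Qed.

HB.instance Definition _ := isMeasure.Build _ _ _ lebesgue_cons
  lebesgue_cons0 lebesgue_cons_ge0 lebesgue_cons_sigma_additive.

End LebesgueCons.

(** Identifies the recursively defined set function with a measure. Finiteness on balls travels with
    the induction: it makes the next product sigma-finite, and it later bounds the volumes of
    pieces. *)
Lemma lebesgue_n_measure (R : realType) n :
  exists mu : {sigma_finite_measure set (borel 'rV[R]_n) -> \bar R},
    (mu : set _ -> _) = @lebesgue_n R n /\
    forall e, (mu (ball (0%R : 'rV[R]_n) e) < +oo)%E.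
Proof.
elim: n => [|n [mu [muE muB]]].
  exists [the {sigma_finite_measure set (borel 'rV[R]_0) -> \bar R} of
    \d_(0 : borel 'rV[R]_0)]; split => // e.
  by rewrite /= diracE ltry.
have nuE : lebesgue_cons mu = @lebesgue_n R n.+1.
  apply/funext => A; rewrite /lebesgue_cons /product_measure1 /=.
  apply: eq_integral => t _ /=; rewrite -muE; congr (mu _).
  by apply/seteqP; split => y; rewrite /xsection /= inE.
have nuB e : (lebesgue_cons mu (ball (0%R : 'rV[R]_n.+1) e) < +oo)%E.
  rewrite /lebesgue_cons cons_rV_ball product_measure1E; last 2 first.
  - by rewrite ball_itv; exact: measurable_itv.
  - by apply: open_borel; exact: ball_open.
  have -> : \row_j (0 : 'rV[R]_n.+1) ord0 (lift ord0 j) = 0.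
    by apply/matrixP => i j; rewrite !mxE.
  apply: lte_mul_pinfty; [exact: measure_ge0| |exact: muB].
  rewrite ge0_fin_numE ?measure_ge0// mxE ball_itv /= lebesgue_measure_itv /=.
  by case: ifPn => _; rewrite ltry.
have sf : sigma_finite setT (lebesgue_cons mu).
  exists (fun k => ball (0%R : 'rV[R]_n.+1) k%:R).
    apply/esym; rewrite -subTset => y _; exists (Num.bound `|y|) => //.
    rewrite -ball_normE /= sub0r normrN; exact: archi_boundP.
  by move=> k; split; [apply: open_borel; exact: ball_open|exact: nuB].
pose S := Measure_isSigmaFinite.Build _ _ _ (lebesgue_cons mu) sf.
pose nu : {sigma_finite_measure set (borel 'rV[R]_n.+1) -> \bar R} :=
  HB.pack (lebesgue_cons mu) S.
by exists nu.
Qed.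

(** * Pieces of the manifold *)

Lemma open_setI_preimage (T1 T2 : topologicalType) (D : set T1) (f : T1 -> T2) A :
  open D -> (forall x, D x -> {for x, continuous f}) -> open A ->
  open (D `&` f @^-1` A).
Proof.
move=> oD cf oA; rewrite openE => x [Dx fAx]; apply: filterI.
  exact: open_nbhs_nbhs.
by apply: (cf x Dx); exact: open_nbhs_nbhs.
Qed.

Lemma open_borel_fun (T1 T2 : ptopologicalType) (D : set T1) (f : T1 -> T2) :
  open D -> (forall x, D x -> {for x, continuous f}) ->
  measurable_fun (D : set (borel T1)) (f : borel T1 -> borel T2).
Proof.
move=> oD cf; apply: (@measurability _ _ (borel T1) (borel T2) _ _ (@open T2)) => //.
move=> _ [A oA <-]; apply: open_borel; exact: open_setI_preimage.
Qed.

Lemma open_borel_real (T : ptopologicalType) (R : realType) (D : set T) (f : T -> R) :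
  open D -> (forall x, D x -> {for x, continuous f}) ->
  measurable_fun (D : set (borel T)) (f : borel T -> R).
Proof.
move=> oD cf; apply: (@measurability _ _ (borel T) R D f (@measurable_realfun.RGenOpens.G R)).
  exact: measurable_realfun.RGenOpens.measurableE.
move=> _ [_ [a [b ->]] <-]; apply: open_borel; apply: open_setI_preimage => //.
Qed.

Lemma bounded_fun_compact (T : topologicalType) (R : realType) (V : normedModType R)
    (K : set T) (f : T -> V) :
  compact K -> (forall x, K x -> {for x, continuous f}) ->
  exists2 C : R, 0 < C & forall x, K x -> `|f x| <= C.
Proof.
move=> cK cf; have : compact (f @` K).
  by apply: continuous_compact => //; apply: continuous_in_subspaceT => x /[!inE]; exact: cf.
move=> /compact_bounded/pinfty_ex_gt0[C C0 h].
by exists C => // x Kx; apply: h; exists x.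
Qed.

Lemma lebesgueP (R : realType) n :
  {mu : {sigma_finite_measure set (borel 'rV[R]_n) -> \bar R} |
    (mu : set _ -> _) = @lebesgue_n R n /\
    forall e, (mu (ball (0%R : 'rV[R]_n) e) < +oo)%E}.
Proof. exact: cid (lebesgue_n_measure R n). Qed.

Definition lebesgue (R : realType) n :
  {sigma_finite_measure set (borel 'rV[R]_n) -> \bar R} := projT1 (lebesgueP R n).

Lemma lebesgueE (R : realType) n : @lebesgue_n R n = lebesgue R n :> (set _ -> _).
Proof. by rewrite /lebesgue; case: lebesgueP => mu [/= <-]. Qed.

Lemma lebesgue_ball (R : realType) n (e : R) :
  (lebesgue R n (ball (0%R : 'rV[R]_n) e) < +oo)%E.
Proof. by rewrite /lebesgue; case: lebesgueP => mu [/= _]. Qed.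

Section Pieces.
Context {R : realType} {n : nat} (M : manifold R n).

Local Notation ch k := (chart_cover M k).1.
Local Notation pc := (@piece R n M).

Lemma chart_coverP : good_cover (chart_cover M).
Proof. exact: projT2 (cid (good_cover_exists M)). Qed.

Lemma ch_atlas k : atlas (ch k). Proof. by have [] := chart_coverP. Qed.

Lemma ch_chart k : is_chart (ch k).
Proof. exact: atlas_chart (ch_atlas k). Qed.

Lemma open_cimg k : open (cimg (ch k)). Proof. by have [] := ch_chart k. Qed.

Lemma piece_closure k : pc k `<=` closure (chart_cover M k).2.
Proof.
apply: subset_trans (@subset_closure _ _).
exact: (@subset_seqDU _ (fun j => (chart_cover M j).2)).
Qed.

Lemma piece_cdom k : pc k `<=` cdom (ch k).
Proof.
by apply: subset_trans (@piece_closure k) _; have [_ _ _ h _] := chart_coverP; exact: h.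
Qed.

Lemma measurable_piece k : measurable (pc k : set (borel M)).
Proof.
apply: seqDU_measurable => j; apply: open_borel.
by have [_ h _ _ _] := chart_coverP; exact: h.
Qed.

Lemma trivIset_piece : trivIset setT (pc).
Proof. exact: trivIset_seqDU. Qed.

Lemma bigcup_piece : \bigcup_k pc k = setT.
Proof. by rewrite /piece -seqDU_bigcup_eq; have [] := chart_coverP. Qed.

Lemma pieceP (x : M) : exists k, pc k x.
Proof. by have : setT x by []; rewrite -bigcup_piece => -[k _]; exists k. Qed.

Lemma chart_atE k x : pc k x -> chart_at x = ch k.
Proof.
move=> kx; rewrite /chart_at; congr (chart_cover M _).1.
case: xgetP => [j -> jx|/(_ k)//].
exact: (trivIset_piece I I (ex_intro _ x (conj jx kx))).
Qed.

Lemma cinvK k x : cdom (ch k) x -> cinv (ch k) (ch k x) = x.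
Proof. by have [_ _ h _ _] := ch_chart k; exact: h. Qed.

(** Trades an image for a preimage under the inverse chart, which is continuous on the chart image;
    this is how images of Borel sets are seen to be Borel. *)
Lemma image_pieceE k (A : set M) : ch k @` (A `&` pc k) =
  cimg (ch k) `&` cinv (ch k) @^-1` (A `&` pc k).
Proof.
apply/seteqP; split => [_ [x [Ax kx] <-]|y [[x dx <-]]] /=.
  have dx := piece_cdom kx; split; first by exists x.
  by rewrite cinvK.
by rewrite cinvK// => h; exists x.
Qed.

Lemma measurable_image_piece k (A : set (borel M)) : measurable A ->
  measurable (ch k @` (A `&` pc k) : set (borel 'rV[R]_n)).
Proof.
move=> mA; rewrite image_pieceE.
have mi : measurable_fun (cimg (ch k) : set (borel 'rV[R]_n))
    (cinv (ch k) : borel 'rV[R]_n -> borel M).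
  by apply: open_borel_fun; [exact: open_cimg|have [] := ch_chart k].
apply: mi; first by apply: open_borel; exact: open_cimg.
by apply: measurableI => //; exact: measurable_piece.
Qed.

Lemma image_piece_cimg k (A : set M) : ch k @` (A `&` pc k) `<=` cimg (ch k).
Proof. by rewrite image_pieceE => y []. Qed.

(** A piece lies in a compact set contained in the chart domain. *)
Lemma bounded_on_piece k (F : 'rV[R]_n -> R) :
  (forall y, cimg (ch k) y -> {for y, continuous F}) ->
  exists2 C : R, 0 < C & forall x, pc k x -> `|F (ch k x)| <= C.
Proof.
move=> cF; have [_ _ cV Vd _] := chart_coverP; have [_ _ _ cc _] := ch_chart k.
have [C C0 CP] := @bounded_fun_compact _ _ _ _ (F \o ch k) (cV k)
  (fun x Vx => continuous_comp (cc x (Vd k x Vx)) (cF _ (ex_intro2 _ _ x (Vd k x Vx) erefl))).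
by exists C => // x /piece_closure; exact: CP.
Qed.

Lemma image_piece_ball k : exists e, ch k @` (pc k) `<=` ball (0 : 'rV[R]_n) e.
Proof.
have [_ _ cV Vd _] := chart_coverP; have [_ _ _ cc _] := ch_chart k.
have [C C0 CP] := @bounded_fun_compact _ _ 'rV[R]_n _ (ch k) (cV k)
  (fun x Vx => cc x (Vd k x Vx)).
exists (C + 1) => _ [x /piece_closure/CP xC <-].
by rewrite -ball_normE /= sub0r normrN; lra.
Qed.

(** Pointwise quantities are computed in a chart that changes from piece to piece, so their
    continuity is recorded chart by chart. Continuity of [F] on the whole chart image, not only over
    the piece, gives boundedness on each piece. *)
Definition chartwise_continuous (f : M -> R) := forall k, exists F,
  (forall y, cimg (ch k) y -> {for y, continuous F}) /\
  (forall x, pc k x -> f x = F (ch k x)).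

Lemma chartwise_measurable f : chartwise_continuous f ->
  measurable_fun setT (f : borel M -> R).
Proof.
move=> cf; rewrite -bigcup_piece.
apply/measurable_fun_bigcup => [k|k]; first exact: measurable_piece.
have [F [cF fF]] := cf k; have [oD _ _ cc _] := ch_chart k.
apply: (@eq_measurable_fun _ _ (borel M) R _ (F \o ch k)).
  by move=> x /[!inE] kx; rewrite /= -fF.
apply: (@measurable_funS _ _ (borel M) R (cdom (ch k))).
- exact: open_borel.
- exact: piece_cdom.
- apply: open_borel_real => // x dx.
  by apply: continuous_comp; [exact: cc|apply: cF; exists x].
Qed.

Lemma chartwise_bounded f k : chartwise_continuous f ->
  exists2 C : R, 0 < C & forall x, pc k x -> `|f x| <= C.
Proof.
move=> cf; have [F [cF fF]] := cf k; have [C C0 CP] := bounded_on_piece cF.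
by exists C => // x kx; rewrite fF//; exact: CP.
Qed.

(** Finitely many sets of the cover contain the support, and a piece is disjoint from all earlier
    sets of the cover. *)
Lemma compact_supp_pieces (v : M -> R) : compactly_supported v ->
  exists N, forall k x, (N <= k)%N -> pc k x -> ~ closure [set x | v x != 0] x.
Proof.
rewrite /compactly_supported compact_cover.
move=> /(_ _ setT (fun j => (chart_cover M j).2)); case.
- by move=> j _; have [_ h _ _ _] := chart_coverP; exact: h.
- by move=> x _; have [_ _ _ _ h] := chart_coverP; have : setT x by []; rewrite -h.
(* One more than the largest index of the subcover, so that every [k] from this bound on comes
   strictly after the whole subcover. *)
move=> D _ Dcov; exists (\max_(i <- finmap.enum_fset D) i).+1 => k x Nk kx vx.
have [j jD jx] := Dcov x vx.
have : (j < k)%N by apply: leq_trans Nk; rewrite ltnS; exact: leq_bigmax_seq.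
move=> jk; have [_ h] := kx; apply: h.
rewrite -(bigcup_mkord k (fun j => (chart_cover M j).2)).
by exists j.
Qed.

Lemma chartwise_bounded_lt f N : chartwise_continuous f ->
  exists2 C : R, 0 < C & forall k x, (k < N)%N -> pc k x -> `|f x| <= C.
Proof.
move=> cf; elim: N => [|N [C C0 CP]]; first by exists 1.
have [D D0 DP] := chartwise_bounded N cf.
exists (C + D) => [|k x]; first by rewrite addr_gt0.
rewrite ltnS leq_eqVlt => /orP[/eqP ->|kN] kx.
  by apply: le_trans (DP x kx) _; rewrite lerDr ltW.
by apply: le_trans (CP k x kN kx) _; rewrite lerDl ltW.
Qed.

End Pieces.

(** * The Riemannian measure *)

Section Volume.
Context {R : realType} {n : nat} (M : manifold R n).
Implicit Types (g h : metric M).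

Local Notation ch k := (chart_cover M k).1.
Local Notation pc := (@piece R n M).

Lemma metric_posdef g k y : cimg (ch k) y -> posdef (g (ch k) y).
Proof. by move=> cy u u0; exact: (metric_pos g (ch_atlas M k) cy u0). Qed.

Lemma metric_symm g k y : cimg (ch k) y -> (g (ch k) y)^T = g (ch k) y.
Proof. by move=> cy; exact: (Defs.metric_sym g (ch_atlas M k) cy). Qed.

Lemma metric_Ck g k m i j : Ck_on m (cimg (ch k)) (fun y => g (ch k) y i j).
Proof. exact: (metric_smooth g (ch_atlas M k) i j m). Qed.

Lemma metric_unit g k y : cimg (ch k) y -> g (ch k) y \in unitmx.
Proof. by move=> cy; apply: posdef_unit; [exact: metric_symm|exact: metric_posdef]. Qed.

Definition density g k y : R := Num.sqrt (\det (g (ch k) y)).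

Lemma density_continuous g k y :
  cimg (ch k) y -> {for y, continuous (density g k)}.
Proof.
move=> cy; apply: (@continuous_comp _ _ _ (fun y => \det (g (ch k) y)) Num.sqrt).
  apply: (Ck_on_cont (k := 0) _ cy).
  by apply: Ck_on_det; [exact: open_cimg|move=> i j; exact: metric_Ck].
exact: sqrt_continuous.
Qed.

Lemma density_measurable g k (A : set 'rV[R]_n) : A `<=` cimg (ch k) ->
  measurable_fun (A : set (borel 'rV[R]_n)) (fun y : borel 'rV[R]_n => (density g k y)%:E).
Proof.
move=> AU; apply/measurable_EFinP.
apply: (@measurable_funS _ _ (borel 'rV[R]_n) R (cimg (ch k))) => //.
  by apply: open_borel; exact: open_cimg.
by apply: open_borel_real; [exact: open_cimg|exact: density_continuous].
Qed.

Local Open Scope ereal_scope.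

Definition piece_vol g k (A : set (borel M)) : \bar R :=
  \int[lebesgue R n]_(y in (ch k @` (A `&` pc k) : set (borel 'rV[R]_n)))
    (density g k y)%:E.

Let piece_vol0 g k : piece_vol g k set0 = 0.
Proof. by rewrite /piece_vol set0I image_set0 integral_set0. Qed.

Let piece_vol_ge0 g k A : 0 <= piece_vol g k A.
Proof. by apply: integral_ge0 => y _; rewrite lee_fin sqrtr_ge0. Qed.

Let piece_vol_sigma_additive g k : semi_sigma_additive (piece_vol g k).
Proof.
move=> F mF tF mUF.
have -> : piece_vol g k (\bigcup_i F i) = \sum_(i <oo) piece_vol g k (F i).
  rewrite /piece_vol setI_bigcupl image_bigcup ge0_integral_bigcup//.
  - by move=> i; exact: measurable_image_piece.
  - apply: density_measurable => y [i _]; exact: image_piece_cimg.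
  - by move=> y _; rewrite lee_fin sqrtr_ge0.
  - apply/trivIsetP => i j _ _ ij; apply/seteqP; split => // y [].
    move=> [x [Fx kx] <-] [x' [Fx' kx']] xx'.
    (* The chart is injective on its domain, so disjoint sets have disjoint images. *)
    have E : x' = x.
      rewrite -(cinvK (piece_cdom kx)) -(cinvK (piece_cdom kx')) xx'.
      by [].
    move/trivIsetP : tF => /(_ i j I I ij) /seteqP[h _].
    by apply: (h x); split => //; rewrite -E.
by apply/cvg_closeP; split; [exact: is_cvg_nneseries|rewrite closeE].
Qed.

HB.instance Definition _ g k := isMeasure.Build _ _ _ (piece_vol g k)
  (piece_vol0 g k) (piece_vol_ge0 g k) (@piece_vol_sigma_additive g k).

Lemma volE g : vol g = mseries (piece_vol g) 0.
Proof. by apply/funext => A; rewrite /vol lebesgueE. Qed.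

Let vol0 g : vol g set0 = 0. Proof. by rewrite volE measure0. Qed.

Let vol_ge0 g A : 0 <= vol g A. Proof. by rewrite volE measure_ge0. Qed.

Let vol_sigma_additive g : semi_sigma_additive (vol g).
Proof. by rewrite volE; exact: measure_semi_sigma_additive. Qed.

HB.instance Definition _ g := isMeasure.Build _ _ _ (vol g)
  (vol0 g) (vol_ge0 g) (@vol_sigma_additive g).

(** The density is bounded on the piece and the image of the piece lies in a ball. *)
Lemma vol_piece_lty g k : vol g (pc k) < +oo.
Proof.
have [e Be] := image_piece_ball M k.
have [C C0 CP] := @bounded_on_piece _ _ M k (density g k) (@density_continuous g k).
have -> : vol g (pc k) = piece_vol g k (pc k).
  rewrite volE /mseries (@nneseriesD1 _ _ k)//= eseries0 ?adde0// => i _ ik.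
  rewrite /piece_vol (_ : pc k `&` pc i = set0) ?image_set0 ?integral_set0//.
  by move/trivIsetP : (@trivIset_piece R n M) => /(_ k i I I); apply; rewrite eq_sym.
rewrite /piece_vol setIid.
apply: (@le_lt_trans _ _ (\int[lebesgue R n]_(y in ball (0%R : 'rV[R]_n) e) C%:E)).
  apply: (@le_trans _ _ (\int[lebesgue R n]_(y in (ch k @` (pc k))) C%:E)).
    apply: ge0_le_integral => //.
    - by rewrite -{1}(setIid (pc k)); apply: measurable_image_piece; exact: measurable_piece.
    - by move=> y _; rewrite lee_fin sqrtr_ge0.
    - by apply: density_measurable; rewrite -{1}(setIid (pc k)); exact: image_piece_cimg.
    - by move=> _ [x kx <-]; rewrite lee_fin; apply: le_trans (ler_norm _) (CP x kx).
  apply: ge0_subset_integral => //.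
  - by rewrite -{1}(setIid (pc k)); apply: measurable_image_piece; exact: measurable_piece.
  - by apply: open_borel; exact: ball_open.
  - by move=> y _; rewrite lee_fin ltW.
rewrite integral_cst; last by apply: open_borel; exact: ball_open.
by apply: lte_mul_pinfty; rewrite ?lee_fin ?ltW//; exact: lebesgue_ball.
Qed.

Lemma le_vol g h (c : R) : (0 <= c)%R ->
  (forall k x, pc k x -> (density h k (ch k x) <= c * density g k (ch k x))%R) ->
  forall A, measurable A -> vol h A <= c%:E * vol g A.
Proof.
move=> c0 gh A mA; rewrite !volE /mseries -nneseriesZl//.
apply: lee_nneseries => // k _; rewrite /piece_vol.
have mI := measurable_image_piece k mA.
have mD g' := @density_measurable g' k _ (@image_piece_cimg _ _ _ k A).
have D0 g' y : 0 <= (density g' k y)%:E by rewrite lee_fin sqrtr_ge0.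
rewrite -ge0_integralZl//.
apply: ge0_le_integral => //; first exact: measurable_funeM.
by move=> _ [x [_ kx] <-]; rewrite -EFinM lee_fin; exact: gh.
Qed.

(** Pointwise comparison of densities gives domination of measures, hence of integrals of
    nonnegative functions, with the constant [c] absorbed into a scaled measure. *)
Lemma le_integral_vol g h (c : R) (f : M -> \bar R) : (0 <= c)%R ->
  (forall k x, pc k x -> (density h k (ch k x) <= c * density g k (ch k x))%R) ->
  (forall x, 0 <= f x) -> measurable_fun setT (f : borel M -> \bar R) ->
  \int[vol h]_x f x <= c%:E * \int[vol g]_x f x.
Proof.
move=> c0 gh f0 mf.
pose c' := NngNum c0.
rewrite (_ : c%:E * _ = \int[mscale c' (vol g)]_x f x); last first.
  by rewrite ge0_integral_mscale.
by apply: ge0_le_measure_integral => // A mA; exact: le_vol.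
Qed.

End Volume.

(** * Chartwise description of the curvature quantities *)

Lemma tensor_norm2_sqr {R : realType} {n : nat} (A : 'M[R]_n) T :
  A^T = A -> posdef A ->
  tensor_norm A 2 T ^+ 2 = \sum_i \sum_k invmx A i k *
    \sum_j \sum_l invmx A j l * (T [:: i; j] * T [:: k; l]).
Proof.
move=> sA pA; rewrite tensor_normE sqr_sqrtr; last first.
  by apply: sumr_ge0 => a _; exact: sqr_ge0.
have PE : invmx A = (frame A)^T *m 1%:M *m frame A.
  by rewrite mulmx1 frame_inv.
have delta (f : 'I_n -> 'I_n -> R) :
    \sum_p \sum_q (1%:M : 'M[R]_n) p q * f p q = \sum_p f p p.
  apply: eq_bigr => p _; rewrite (bigD1 p)//= mxE eqxx mul1r big1 ?addr0// => q qp.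
  by rewrite mxE eq_sym (negbTE qp) mul0r.
under [RHS]eq_bigr do (under eq_bigr do rewrite (trace_frame PE) delta).
rewrite (trace_frame PE) delta big_cons_tuple; apply: eq_bigr => a _.
rewrite big_cons_tuple /ct2; under [RHS]eq_ct do rewrite ct_sum.
rewrite ct_sum; apply: eq_bigr => b _.
rewrite (big_pred1 [tuple]); last by move=> t; apply/esym/eqP; exact: tuple0.
rewrite expr2 /= -!/(ct _ _ _).
under [RHS]eq_ct do (under eq_ct do (under eq_ct do rewrite ctMl; rewrite ctMr)).
under [RHS]eq_ct do rewrite ctMl.
by rewrite ctMr.
Qed.

Section Chartwise.
Context {R : realType} {n : nat} (M : manifold R n).
Implicit Types (g h : metric M) (v : M -> R).

Local Notation ch k := (chart_cover M k).1.
Local Notation pc := (@piece R n M).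

Lemma scalE g k x : pc k x -> scal g x = scalar_curvature (g (ch k)) (ch k x).
Proof. by move=> kx; rewrite /scal (chart_atE kx). Qed.

Lemma ric_normE g k x : pc k x -> ric_norm g x = tensor_norm (g (ch k) (ch k x)) 2
  (fun I => mxtensor (fun y => \matrix_(i, j) ricci (g (ch k)) i j y) I (ch k x)).
Proof. by move=> kx; rewrite /ric_norm (chart_atE kx). Qed.

Lemma differential_normE g v k x : pc k x ->
  differential_norm g v x = tensor_norm (g (ch k) (ch k x)) 1
    (fun I => if I is [:: i] then pd i (v \o cinv (ch k)) (ch k x) else 0).
Proof. by move=> kx; rewrite /differential_norm (chart_atE kx). Qed.

Lemma nabla_normE g i T k x : pc k x -> nabla_norm g i T x =
  tensor_norm (g (ch k) (ch k x)) (i + 2)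
    (fun I => iter i (covd (g (ch k))) (mxtensor (T (ch k))) I (ch k x)).
Proof. by move=> kx; rewrite /nabla_norm (chart_atE kx). Qed.

Lemma chartwise_Ck0 (f : M -> R) (F : nat -> 'rV[R]_n -> R) :
  (forall k, Ck_on 0 (cimg (ch k)) (F k)) ->
  (forall k x, pc k x -> f x = F k (ch k x)) -> chartwise_continuous f.
Proof.
move=> CF fF k; exists (F k); split; last exact: fF.
by move=> y cy; exact: (Ck_on_cont (CF k) cy).
Qed.

Lemma chartwise_smooth v : smooth_fun v -> chartwise_continuous v.
Proof.
move=> sv; apply: (@chartwise_Ck0 _ (fun k => v \o cinv (ch k))).
  by move=> k; exact: (sv _ (ch_atlas M k)).
by move=> k x /piece_cdom dx; rewrite /= cinvK.
Qed.

Lemma chartwise_scal g : chartwise_continuous (scal g).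
Proof.
apply: (@chartwise_Ck0 _ (fun k => scalar_curvature (g (ch k)))); last exact: scalE.
move=> k; apply: Ck_on_scalar; first exact: open_cimg.
  by move=> y; exact: metric_unit.
by move=> i j; exact: metric_Ck.
Qed.

Lemma Ck_on_invmetric g k m i j :
  Ck_on m (cimg (ch k)) (fun y => invmx (g (ch k) y) i j).
Proof.
apply: Ck_on_invmx; first exact: open_cimg.
  by move=> y; exact: metric_unit.
by move=> a b; exact: metric_Ck.
Qed.

Lemma piece_cimg k x : pc k x -> cimg (ch k) (ch k x).
Proof. by move=> kx; exists x => //; exact: piece_cdom. Qed.

Lemma chartwise_differential_norm g v : smooth_fun v ->
  chartwise_continuous (fun x => differential_norm g v x ^+ 2).
Proof.
move=> sv; apply: (@chartwise_Ck0 _ (fun k y => \sum_i \sum_j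
  invmx (g (ch k) y) i j *
  (pd i (v \o cinv (ch k)) y * pd j (v \o cinv (ch k)) y))).
  move=> k; have oU := @open_cimg R n M k.
  do 2 (apply: Ck_on_sum => // ?); apply: Ck_onM => //.
    exact: Ck_on_invmetric.
  by apply: Ck_onM => //; apply: Ck_on_pd; exact: (sv _ (ch_atlas M k)).
move=> k x kx; rewrite (differential_normE _ _ kx) tensor_norm1_sqr//.
  exact/metric_symm/piece_cimg.
exact/metric_posdef/piece_cimg.
Qed.

Lemma chartwise_ric_norm g : chartwise_continuous (fun x => ric_norm g x ^+ 2).
Proof.
apply: (@chartwise_Ck0 _ (fun k y => \sum_i \sum_p invmx (g (ch k) y) i p *
    \sum_j \sum_l invmx (g (ch k) y) j l *
      (ricci (g (ch k)) i j y * ricci (g (ch k)) p l y))).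
  move=> k; have oU := @open_cimg R n M k.
  have CR i j : Ck_on 0 (cimg (ch k)) (ricci (g (ch k)) i j).
    apply: Ck_on_ricci => //; first by move=> y; exact: metric_unit.
    by move=> a b; exact: metric_Ck.
  do 2 (apply: Ck_on_sum => // ?); apply: Ck_onM => //.
    exact: Ck_on_invmetric.
  do 2 (apply: Ck_on_sum => // ?); apply: Ck_onM => //.
    exact: Ck_on_invmetric.
  by apply: Ck_onM.
move=> k x kx; rewrite (ric_normE _ kx) tensor_norm2_sqr.
- do 2 (apply: eq_bigr => ? _); congr (_ * _); do 2 (apply: eq_bigr => ? _).
  by rewrite /= !mxE.
- exact/metric_symm/piece_cimg.
- exact/metric_posdef/piece_cimg.
Qed.

Lemma nabla_norm_ge0 g i T x : 0 <= nabla_norm g i T x.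
Proof. exact: tensor_norm_ge0. Qed.

Lemma nabla_norm_lt g m T (e : R) (i : 'I_m.+1) x :
  (Ck_norm g m T < e%:E)%E -> nabla_norm g i T x < e.
Proof.
move=> Te; rewrite -lte_fin; apply: le_lt_trans Te; rewrite /Ck_norm (bigD1 i)//=.
pose S (j : 'I_m.+1) := ereal_sup [set (nabla_norm g j T x)%:E | x in [set: M]].
have Sx (j : 'I_m.+1) y : ((nabla_norm g j T y)%:E <= S j)%E by apply: ereal_sup_ubound; exists y.
apply: le_trans (Sx i x) _; rewrite leeDl//; apply: sume_ge0 => j _.
by apply: le_trans (Sx j x); rewrite lee_fin nabla_norm_ge0.
Qed.

(** [metric_perturbation] applied in the chart of the piece containing the point, with one radius
    for all metrics and points. *)
Lemma Ck_ball_close (e : R) : 0 < e -> exists2 r : R, 0 < r &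
  forall g h, Ck_ball 2 g r h -> forall k x, pc k x ->
  [/\ density h k (ch k x) <= (1 + e) * density g k (ch k x),
      density g k (ch k x) <= (1 + e) * density h k (ch k x),
      forall v, `|differential_norm h v x ^+ 2 - differential_norm g v x ^+ 2|
        <= e * differential_norm g v x ^+ 2 &
      `|scal h x - scal g x| <= e * (1 + ric_norm g x)].
Proof.
move=> e0; have [r r0 rP] := metric_perturbation n e0; exists r => // g h gh k x kx.
have cx := piece_cimg kx.
have [|||||||h1 h2 h3 h4] := rP (cimg (ch k)) (g (ch k)) (h (ch k)) (ch k x)
  (@open_cimg R n M k) cx.
- by move=> y; exact: metric_symm.
- by move=> y; exact: metric_posdef.
- by move=> y; exact: metric_symm.
- by move=> y; exact: metric_posdef.
- by move=> i j; exact: metric_Ck.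
- by move=> i j; exact: metric_Ck.
- by move=> i; have := nabla_norm_lt i x gh; rewrite (nabla_normE _ _ _ kx).
split; [exact: h1|exact: h2| |].
- by move=> v; rewrite !(differential_normE _ _ kx); apply: h3.
- rewrite (scalE h kx) (scalE g kx) (ric_normE g kx); apply: h4.
Qed.

End Chartwise.

(** * Perturbation of integrals and quotients *)

Section IntegralPerturbation.
Context d (T : measurableType d) (R : realType).
Variables (mu nu : {measure set T -> \bar R}) (e : R).
Hypothesis e01 : 0 <= e <= 1.
Local Open Scope ereal_scope.
Hypothesis nu_mu : forall f : T -> \bar R, (forall x, 0 <= f x) ->
  measurable_fun setT f -> \int[nu]_x f x <= (1 + e)%:E * \int[mu]_x f x.
Hypothesis mu_nu : forall f : T -> \bar R, (forall x, 0 <= f x) ->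
  measurable_fun setT f -> \int[mu]_x f x <= (1 + e)%:E * \int[nu]_x f x.
Variable F : T -> R.
Hypothesis F0 : forall x, (0 <= F x)%R.
Hypothesis mF : measurable_fun setT F.
Hypothesis Foo : \int[mu]_x (F x)%:E < +oo.
Let Phi := fine (\int[mu]_x (F x)%:E).

(** Passes through the integral of [w] against [mu]: first the function changes, then the
    measure. *)
Lemma ge0_integral_perturb (u w : T -> R) :
  (forall x, 0 <= u x <= F x)%R -> (forall x, 0 <= w x)%R ->
  measurable_fun setT u -> measurable_fun setT w ->
  (forall x, w x <= u x + e * F x)%R -> (forall x, u x <= w x + e * F x)%R ->
  [/\ (\int[mu]_x (u x)%:E)%E \is a fin_num, (\int[nu]_x (w x)%:E)%E \is a fin_num,
      fine ((\int[mu]_x (u x)%:E)%E) <= Phi &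
      `|fine ((\int[nu]_x (w x)%:E)%E) - fine ((\int[mu]_x (u x)%:E)%E)| <= 5 * e * Phi]%R.
Proof.
move=> u0F w0 mu_ mw wu uw; have [e0 e1] := andP e01.
have u0 x : (0 <= u x)%R by have /andP[] := u0F x.
have uF x : (u x <= F x)%R by have /andP[] := u0F x.
have int0 (m : {measure set T -> \bar R}) (f : T -> R) : (forall x, 0 <= f x)%R ->
    0 <= \int[m]_x (f x)%:E by move=> f0; apply: integral_ge0 => x _; rewrite lee_fin.
have mE (f : T -> R) : measurable_fun setT f -> measurable_fun setT (EFin \o f).
  by move=> mf; exact/measurable_EFinP.
have le_mu (m : {measure set T -> \bar R}) (f g : T -> R) : (forall x, 0 <= f x)%R ->
    measurable_fun setT f -> measurable_fun setT g -> (forall x, f x <= g x)%R ->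
    \int[m]_x (f x)%:E <= \int[m]_x (g x)%:E.
  move=> f0 mf mg fg; apply: ge0_le_integral => //.
  - by move=> x _; rewrite lee_fin.
  - exact: mE.
  - exact: mE.
  - by move=> x _; rewrite lee_fin.
have split_mu (f : T -> R) : (forall x, 0 <= f x)%R -> measurable_fun setT f ->
    \int[mu]_x (f x + e * F x)%:E = \int[mu]_x (f x)%:E + e%:E * \int[mu]_x (F x)%:E.
  move=> f0 mf; under eq_integral do rewrite EFinD.
  rewrite ge0_integralD//.
  - congr (_ + _); under eq_integral do rewrite EFinM.
    by rewrite ge0_integralZl_EFin//; [move=> x _; rewrite lee_fin|exact: mE].
  - by move=> x _; rewrite lee_fin.
  - exact: mE.
  - by move=> x _; rewrite lee_fin mulr_ge0.
  - by apply: mE; exact: measurable_funM.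
have meF (f : T -> R) : measurable_fun setT f ->
    measurable_fun setT (fun x => f x + e * F x)%R.
  by move=> mf; apply: measurable_funD => //; exact: measurable_funM.
have PhiE : \int[mu]_x (F x)%:E = Phi%:E.
  by rewrite fineK// ge0_fin_numE// int0.
have uPhi : \int[mu]_x (u x)%:E <= Phi%:E by rewrite -PhiE; exact: le_mu.
have ufin : \int[mu]_x (u x)%:E \is a fin_num.
  by rewrite ge0_fin_numE ?int0//; apply: le_lt_trans uPhi _; rewrite ltry.
have w_mu : \int[mu]_x (w x)%:E <= \int[mu]_x (u x)%:E + e%:E * Phi%:E.
  by rewrite -PhiE -split_mu//; apply: le_mu => //; exact: meF.
have u_mu : \int[mu]_x (u x)%:E <= \int[mu]_x (w x)%:E + e%:E * Phi%:E.
  by rewrite -PhiE -split_mu//; apply: le_mu => //; exact: meF.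
have w_mufin : \int[mu]_x (w x)%:E \is a fin_num.
  rewrite ge0_fin_numE ?int0//; apply: le_lt_trans w_mu _.
  by rewrite -(fineK ufin) -EFinM -EFinD ltry.
have w_nu : \int[nu]_x (w x)%:E <= (1 + e)%:E * \int[mu]_x (w x)%:E.
  by apply: nu_mu; [move=> x; rewrite lee_fin|exact: mE].
have nu_w : \int[mu]_x (w x)%:E <= (1 + e)%:E * \int[nu]_x (w x)%:E.
  by apply: mu_nu; [move=> x; rewrite lee_fin|exact: mE].
have wfin : \int[nu]_x (w x)%:E \is a fin_num.
  rewrite ge0_fin_numE ?int0//; apply: le_lt_trans w_nu _.
  by rewrite -(fineK w_mufin) -EFinM ltry.
split => //; first by rewrite -lee_fin fineK.
move: uPhi w_mu u_mu w_nu nu_w (int0 mu u u0) (int0 mu w w0) (int0 nu w w0).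
rewrite -(fineK ufin) -(fineK w_mufin) -(fineK wfin) /= -!EFinM -!EFinD !lee_fin /=.
set a := fine _; set b := fine _; set c := fine _ => h1 h2 h3 h4 h5 a0 b0 c0.
have P0 : (0 <= e * Phi)%R by rewrite mulr_ge0// (le_trans a0).
have h6 : (e * (e * Phi) <= e * Phi)%R by rewrite ler_piMl.
(* Since e <= 1, b <= 2 Phi and c <= 2 b <= 4 Phi. The error is then e Phi from the functions plus
   at most 4 e Phi from the measures, whence the constant 5. *)
have h7 : (e * b <= e * (2 * Phi))%R.
  by rewrite ler_wpM2l//; have : (e * Phi <= Phi)%R; [rewrite ler_piMl// (le_trans a0)|lra].
have h8 : (e * c <= e * (4 * Phi))%R.
  rewrite ler_wpM2l//.
  have : (e * Phi <= Phi)%R by rewrite ler_piMl// (le_trans a0).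
  lra.
rewrite ler_norml; lra.
Qed.

(** Positive and negative parts are 1-Lipschitz in the function, so the nonnegative case applies to
    each; this doubles the constant. *)
Lemma integral_perturb (u w : T -> R) :
  (forall x, `|u x| <= F x)%R ->
  measurable_fun setT u -> measurable_fun setT w ->
  (forall x, `|w x - u x| <= e * F x)%R ->
  (`|fine ((\int[mu]_x (u x)%:E)%E)| <= 2 * Phi /\
   `|fine ((\int[nu]_x (w x)%:E)%E) - fine ((\int[mu]_x (u x)%:E)%E)| <= 10 * e * Phi)%R.
Proof.
move=> uF mu_ mw wu; have [e0 e1] := andP e01.
pose p (f : T -> R) x := Num.max (f x) 0%R.
pose q (f : T -> R) x := Num.max (- f x)%R 0%R.
have mp f : measurable_fun setT f -> measurable_fun setT (p f).
  by move=> mf; apply: measurable_maxr.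
have mq f : measurable_fun setT f -> measurable_fun setT (q f).
  by move=> mf; apply: measurable_maxr => //; exact: measurable_funN.
have intE (m : {measure set T -> \bar R}) f :
    \int[m]_x (f x)%:E = \int[m]_x (p f x)%:E - \int[m]_x (q f x)%:E.
  rewrite integralE; congr (_ - _); apply: eq_integral => x _.
  by rewrite funeposE /p EFin_max.
  by rewrite funenegE /q EFin_max.
have max_lip (s t r : R) : (`|s - t| <= r -> Num.max s 0 <= Num.max t 0 + r)%R.
  move=> h; have r0 : (0 <= r)%R by apply: le_trans h.
  move: h; rewrite ler_distl => /andP[_ h].
  rewrite ge_max; apply/andP; split.
    by apply: le_trans h _; rewrite lerD2r le_max lexx.
  by rewrite addr_ge0// le_max lexx orbT.
have [a1 a2 a3 a4] : [/\ (\int[mu]_x (p u x)%:E)%E \is a fin_num,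
   (\int[nu]_x (p w x)%:E)%E \is a fin_num, fine ((\int[mu]_x (p u x)%:E)%E) <= Phi &
   `|fine ((\int[nu]_x (p w x)%:E)%E) - fine ((\int[mu]_x (p u x)%:E)%E)| <= 5 * e * Phi]%R.
  apply: ge0_integral_perturb; try exact: mp.
  - move=> x; rewrite /p le_max lexx orbT /= ge_max F0 andbT.
    exact: le_trans (ler_norm _) (uF x).
  - by move=> x; rewrite /p le_max lexx orbT.
  - by move=> x; apply: max_lip; exact: wu.
  - by move=> x; apply: max_lip; rewrite distrC; exact: wu.
have [b1 b2 b3 b4] : [/\ (\int[mu]_x (q u x)%:E)%E \is a fin_num,
   (\int[nu]_x (q w x)%:E)%E \is a fin_num, fine ((\int[mu]_x (q u x)%:E)%E) <= Phi &
   `|fine ((\int[nu]_x (q w x)%:E)%E) - fine ((\int[mu]_x (q u x)%:E)%E)| <= 5 * e * Phi]%R.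
  apply: ge0_integral_perturb; try exact: mq.
  - move=> x; rewrite /q le_max lexx orbT /= ge_max F0 andbT.
    by apply: le_trans (ler_norm _) _; rewrite normrN.
  - by move=> x; rewrite /q le_max lexx orbT.
  - by move=> x; apply: max_lip; rewrite opprK addrC distrC; exact: wu.
  - by move=> x; apply: max_lip; rewrite opprK addrC; exact: wu.
rewrite (intE mu u) (intE nu w) (fineB a1 b1) (fineB a2 b2).
have a0 : (0 <= fine (\int[mu]_x (p u x)%:E))%R.
  by apply: fine_ge0; apply: integral_ge0 => x _; rewrite lee_fin /p le_max lexx orbT.
have b0 : (0 <= fine (\int[mu]_x (q u x)%:E))%R.
  by apply: fine_ge0; apply: integral_ge0 => x _; rewrite lee_fin /q le_max lexx orbT.
move: a3 a4 b3 b4 a0 b0; rewrite !ler_norml.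
set x1 := fine _; set x2 := fine _; set x3 := fine _; set x4 := fine _.
split; lra.
Qed.

End IntegralPerturbation.

(* If m or m' vanishes, so does the other, and since 0^-1 = 0 both sides are 0. *)
Lemma quotient_perturb {R : realType} (m m' Q Q' P e : R) :
  0 <= e <= 1 -> 0 <= m -> 0 <= m' ->
  m' <= (1 + e) ^+ 2 * m -> m <= (1 + e) ^+ 2 * m' ->
  `|Q| <= 2 * P -> `|Q' - Q| <= 10 * e * P ->
  `|m'^-1 * Q' - m^-1 * Q| <= 100 * e * (P / m).
Proof.
move=> /andP[e0 e1] m0 m0' mm' m'm QP QQ.
have inv_le (x y k : R) : 0 <= x -> 0 <= y -> 0 <= k ->
    x <= k * y -> y <= k * x -> y^-1 <= k * x^-1.
  move=> x0 y0 k0 xy yx; have [y00|y1] := eqVneq y 0.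
    by rewrite y00 invr0 mulr_ge0// invr_ge0.
  have [x00|x1] := eqVneq x 0.
    by move: yx; rewrite x00 mulr0 => yy; move: y1; rewrite eq_le yy y0.
  rewrite ler_pdivlMr ?lt0r ?x1// ler_pdivrMl ?lt0r ?y1//.
  by rewrite mulrC.
have k0 : 0 <= (1 + e) ^+ 2 by exact: sqr_ge0.
have w1 := inv_le _ _ _ m0 m0' k0 m'm mm'.
have u1 := inv_le _ _ _ m0' m0 k0 mm' m'm.
have u0 : 0 <= m^-1 by rewrite invr_ge0.
have w0 : 0 <= m'^-1 by rewrite invr_ge0.
move: w1 u1 u0 w0; set w := m'^-1; set u := m^-1 => w1 u1 u0 w0.
have P0 : 0 <= P by move: (le_trans (normr_ge0 _) QP); lra.
have k4 : (1 + e) ^+ 2 <= 1 + 3 * e by have := ler_wpM2l e0 e1; lra.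
have w2 : w <= (1 + 3 * e) * u by apply: le_trans w1 _; rewrite ler_wpM2r.
have u2 : u <= (1 + 3 * e) * w by apply: le_trans u1 _; rewrite ler_wpM2r.
have eu0 : 0 <= e * u by rewrite mulr_ge0.
have eu1 : e * u <= u by rewrite ler_piMl.
have w4 : w <= 4 * u by lra.
have ew4 : e * w <= 4 * (e * u) by have := ler_wpM2l e0 w4; lra.
have wu : `|w - u| <= 12 * (e * u) by rewrite ler_norml; apply/andP; split; lra.
(* With w <= 4 u and |w - u| <= 12 e u the two summands give 40 and 24 times e P u, together below
   100. *)
have -> : w * Q' - u * Q = w * (Q' - Q) + (w - u) * Q by ring.
apply: le_trans (ler_normD _ _) _; rewrite !normrM (ger0_norm w0).
have h1 := ler_pM w0 (normr_ge0 _) w4 QQ.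
have h2 := ler_pM (normr_ge0 _) (normr_ge0 _) wu QP.
have : 0 <= e * u * P by rewrite mulr_ge0.
rewrite -[P / m]/(P * u); lra.
Qed.

(** * Perturbation of the energy *)

Section TestFunctions.
Context {R : realType} {n : nat} (M : manifold R n).
Hypothesis n3 : (3 <= n)%N.
Implicit Types (g h : metric M) (v : M -> R).

Local Notation ch k := (chart_cover M k).1.
Local Notation pc := (@piece R n M).

Definition crit_exp : R := 2 * n%:R / (n%:R - 2).
Definition yamabe_coef : R := 4 * (n%:R - 1) / (n%:R - 2).
Local Notation p := crit_exp.
Local Notation a := yamabe_coef.

Lemma dim_ge3 : 3 <= n%:R :> R. Proof. by rewrite ler_nat. Qed.

Lemma yamabe_coef_ge0 : 0 <= a.
Proof. by have h := dim_ge3; rewrite divr_ge0//; lra. Qed.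

Lemma crit_exp_ge1 : 1 <= p.
Proof. by have h := dim_ge3; rewrite /p ler_pdivlMr; lra. Qed.

Definition test_fun v := [/\ smooth_fun v, compactly_supported v,
  forall x, 0 <= v x & exists x, v x != 0].

Definition energy_density g v (x : M) : R :=
  a * differential_norm g v x ^+ 2 + scal g x * v x ^+ 2.

Definition energy_majorant g v (x : M) : R :=
  a * differential_norm g v x ^+ 2 + (1 + `|scal g x|) * v x ^+ 2.

Definition mass g v : R := fine (Lp_norm g p v) ^+ 2.

Definition majorant_int g v : R := fine (\int[vol g]_x (energy_majorant g v x)%:E)%E.

Lemma energyE g v : energy g v =
  (mass g v)^-1 * fine (\int[vol g]_x (energy_density g v x)%:E)%E.
Proof. by []. Qed.

Lemma energy_majorant_ge0 g v x : 0 <= energy_majorant g v x.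
Proof.
apply: addr_ge0; apply: mulr_ge0; rewrite ?sqr_ge0 ?yamabe_coef_ge0//.
Qed.

Lemma measurable_scal g : measurable_fun setT (scal g : borel M -> R).
Proof. apply: chartwise_measurable; exact: chartwise_scal. Qed.

Lemma measurable_smooth v : smooth_fun v -> measurable_fun setT (v : borel M -> R).
Proof. by move=> sv; apply: chartwise_measurable; exact: chartwise_smooth. Qed.

Lemma measurable_differential_norm2 g v : smooth_fun v ->
  measurable_fun setT (fun x : borel M => differential_norm g v x ^+ 2).
Proof. by move=> sv; apply: chartwise_measurable; exact: chartwise_differential_norm. Qed.

Lemma measurable_energy_density g v : smooth_fun v ->
  measurable_fun setT (energy_density g v : borel M -> R).
Proof.
move=> sv; apply: measurable_funD; apply: measurable_funM => //.
- exact: measurable_differential_norm2.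
- exact: measurable_scal.
- by apply: measurable_funX; exact: measurable_smooth.
Qed.

Lemma measurable_energy_majorant g v : smooth_fun v ->
  measurable_fun setT (energy_majorant g v : borel M -> R).
Proof.
move=> sv; apply: measurable_funD; apply: measurable_funM => //.
- exact: measurable_differential_norm2.
- apply: measurable_funD => //; apply: measurableT_comp => //.
  exact: measurable_scal.
- by apply: measurable_funX; exact: measurable_smooth.
Qed.

(** Such a function is dominated by a finite sum of multiples of indicators of pieces, each of
    finite volume. *)
Lemma integral_lty g (f : M -> R) N (C : R) : 0 <= C ->
  measurable_fun setT (f : borel M -> R) -> (forall x, 0 <= f x) ->
  (forall k x, (k < N)%N -> pc k x -> f x <= C) ->
  (forall k x, (N <= k)%N -> pc k x -> f x = 0) ->
  (\int[vol g]_x (f x)%:E < +oo)%E.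
Proof.
move=> C0 mf f0 fC fN.
apply: (@le_lt_trans _ _
  (\int[vol g]_x (\sum_(k < N) C%:E * (\1_(pc k) x)%:E))%E).
  apply: ge0_le_integral => //.
  - by move=> x _; rewrite lee_fin.
  - exact/measurable_EFinP.
  - apply: emeasurable_sum => k; apply: measurable_funeM; apply/measurable_EFinP.
    by apply: measurable_indic; exact: measurable_piece.
  - move=> x _; have [k kx] := pieceP x; have [Nk|kN] := leqP N k.
      rewrite (fN k x Nk kx); apply: sume_ge0 => i _.
      by rewrite mule_ge0 ?lee_fin.
    rewrite (bigD1 (Ordinal kN))//= indicE mem_set// mule1.
    apply: le_trans (_ : C%:E <= _)%E; first by rewrite lee_fin; exact: fC kx.
    by rewrite leeDl//; apply: sume_ge0 => i _; rewrite mule_ge0 ?lee_fin.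
rewrite ge0_integral_sum//; last 2 first.
- move=> k; apply: measurable_funeM; apply/measurable_EFinP.
  by apply: measurable_indic; exact: measurable_piece.
- by move=> k x _; rewrite mule_ge0 ?lee_fin.
apply: lte_sum_pinfty => k _.
rewrite ge0_integralZl_EFin//; last first.
  by apply/measurable_EFinP; apply: measurable_indic; exact: measurable_piece.
rewrite integral_indic//; last exact: measurable_piece.
by rewrite setIT; apply: lte_mul_pinfty; rewrite ?lee_fin//; exact: vol_piece_lty.
Qed.

(** The complement of the closed support is open, so [v] vanishes on a neighbourhood of [x] and its
    partial derivatives vanish at [x]. *)
Lemma differential_norm_out g v x : ~ closure [set x | v x != 0] x ->
  differential_norm g v x = 0.
Proof.
move=> vx; have [k kx] := pieceP x; rewrite (differential_normE _ _ kx).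
have cx := piece_cimg kx.
have pd0 i : pd i (v \o cinv (ch k)) (ch k x) = 0.
  rewrite -[RHS](pd_cst i 0 (ch k x)); apply: near_pd.
  have [_ _ _ _ ci] := ch_chart M k.
  have nx : nbhs (cinv (ch k) (ch k x)) (~` closure [set x | v x != 0]).
    rewrite cinvK; last exact: piece_cdom kx.
    by apply: open_nbhs_nbhs; split => //; apply: closed_openC; exact: closed_closure.
  have sub y : (~` closure [set x | v x != 0]) (cinv (ch k) y) ->
      (v \o cinv (ch k)) y = 0.
    by move=> vy; apply/eqP/negPn/negP => v0; apply: vy; exact: subset_closure.
  exact: filterS sub (ci _ cx _ nx).
apply/eqP; rewrite -sqrf_eq0 tensor_norm1_sqr.
- by rewrite big1// => i _; rewrite big1// => j _; rewrite !pd0 mulr0 mulr0.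
- exact: metric_symm.
- exact: metric_posdef.
Qed.

Lemma supp_out v x : ~ closure [set x | v x != 0] x -> v x = 0.
Proof.
by move=> vx; apply/eqP/negPn/negP => v0; apply: vx; exact: subset_closure.
Qed.

Lemma energy_majorant_lty g v : smooth_fun v -> compactly_supported v ->
  (\int[vol g]_x (energy_majorant g v x)%:E < +oo)%E.
Proof.
move=> sv cv; have [N NP] := compact_supp_pieces cv.
have [C1 C10 C1P] := chartwise_bounded_lt N (chartwise_differential_norm g sv).
have [C2 C20 C2P] := chartwise_bounded_lt N (chartwise_scal g).
have [C3 C30 C3P] := chartwise_bounded_lt N (chartwise_smooth sv).
apply: (@integral_lty _ _ N (a * C1 + (1 + C2) * C3 ^+ 2)).
- have a0 := yamabe_coef_ge0.
  by rewrite addr_ge0// mulr_ge0 ?sqr_ge0 ?addr_ge0// ltW.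
- exact: measurable_energy_majorant.
- exact: energy_majorant_ge0.
- move=> k x kN kx; apply: lerD.
    rewrite ler_wpM2l ?yamabe_coef_ge0//.
    exact: le_trans (ler_norm _) (C1P k x kN kx).
  apply: ler_pM; rewrite ?sqr_ge0 ?addr_ge0//.
    by rewrite lerD2l; exact: C2P kx.
  by rewrite -(ger0_norm (sqr_ge0 (v x))) normrX lerXn2r ?nnegrE ?normr_ge0 ?(ltW C30)//; exact: C3P kx.
- move=> k x Nk kx; have vx := NP k x Nk kx.
  by rewrite /energy_majorant (differential_norm_out g vx) (supp_out vx) expr0n !mulr0 addr0.
Qed.

Lemma measurable_powR_abs v (q : R) : smooth_fun v ->
  measurable_fun setT (fun x : borel M => `|v x| `^ q).
Proof.
move=> sv; apply: (measurableT_comp (@measurable_powR R q)).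
by apply: measurableT_comp => //; exact: measurable_smooth.
Qed.

Lemma Lp_int_lty g v : smooth_fun v -> compactly_supported v ->
  (\int[vol g]_x (`|v x| `^ p)%:E < +oo)%E.
Proof.
move=> sv cv; have [N NP] := compact_supp_pieces cv.
have p0 : 0 < p by apply: lt_le_trans crit_exp_ge1.
have [C C0 CP] := chartwise_bounded_lt N (chartwise_smooth sv).
apply: (@integral_lty _ _ N (C `^ p)).
- exact: powR_ge0.
- exact: measurable_powR_abs.
- by move=> x; exact: powR_ge0.
- move=> k x kN kx; apply: ge0_ler_powR; rewrite ?nnegrE ?normr_ge0 ?(ltW p0) ?(ltW C0)//.
  exact: CP kx.
- move=> k x Nk kx; rewrite (supp_out (NP k x Nk kx)).
  by rewrite normr0 powR0// gt_eqF.
Qed.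

Lemma mass_perturb g h v (e : R) : 0 <= e ->
  smooth_fun v -> compactly_supported v ->
  (forall f : M -> \bar R, (forall x, 0 <= f x)%E ->
    measurable_fun setT (f : borel M -> \bar R) ->
    (\int[vol h]_x f x <= (1 + e)%:E * \int[vol g]_x f x)%E) ->
  mass h v <= (1 + e) ^+ 2 * mass g v.
Proof.
move=> e0 sv cv hg.
have int0 g' : (0 <= \int[vol g']_x (`|v x| `^ p)%:E)%E.
  by apply: integral_ge0 => x _; rewrite lee_fin powR_ge0.
have [J JE] : exists J : metric M -> R,
    forall g', (\int[vol g']_x (`|v x| `^ p)%:E = (J g')%:E)%E.
  exists (fun g' => fine (\int[vol g']_x (`|v x| `^ p)%:E)%E) => g'.
  by rewrite fineK// ge0_fin_numE//; exact: Lp_int_lty.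
have massE g' : mass g' v = (J g' `^ p^-1) ^+ 2.
  by rewrite /mass /Lp_norm JE poweR_EFin.
have J0 g' : 0 <= J g' by rewrite -lee_fin -JE.
have JJ : J h <= (1 + e) * J g.
  rewrite -lee_fin EFinM -(JE h) -(JE g); apply: hg.
    by move=> x; rewrite lee_fin powR_ge0.
  by apply/measurable_EFinP; exact: measurable_powR_abs.
rewrite (massE h) (massE g) -[X in _ <= X]exprMn.
have p1 := crit_exp_ge1; have p0 : 0 < p by apply: lt_le_trans p1.
move: (J h) (J g) (J0 h) (J0 g) JJ => Jh Jg Jh0 Jg0 JJ.
have e1 : 0 <= 1 + e by lra.
rewrite lerXn2r ?nnegrE ?powR_ge0 ?mulr_ge0 ?powR_ge0//.
apply: (@le_trans _ _ (((1 + e) * Jg) `^ p^-1)).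
  by apply: ge0_ler_powR; rewrite ?nnegrE ?mulr_ge0// invr_ge0 ltW.
rewrite powRM// ler_wpM2r ?powR_ge0//.
(* As p >= 1, taking the p-th root does not enlarge a factor 1 + e >= 1. *)
apply: ler1_powR; first lra.
by rewrite invf_le1.
Qed.

(** The radius depends neither on [g] nor on [v]. Upper semicontinuity uses this for a single [v],
    lower semicontinuity for all [v] at once. *)
Lemma energy_close (c e : R) : 0 < c -> 0 < e -> exists2 r : R, 0 < r &
  forall g h, Ck_ball 2 g r h -> forall v, smooth_fun v -> compactly_supported v ->
  (forall x, v x != 0 -> ric_norm g x <= c * (1 + `|scal g x|)) ->
  `|energy h v - energy g v| <= e * (majorant_int g v / mass g v).
Proof.
(* The 100 is the constant of [quotient_perturb]; the integral and quotient estimates also require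
   eta <= 1. *)
move=> c0 e0; pose eta := Num.min 1 (e / 100).
have eta0 : 0 < eta by rewrite lt_min ltr01 divr_gt0.
have eta1 : eta <= 1 by rewrite ge_min lexx.
have etae : 100 * eta <= e.
  have : eta <= e / 100 by rewrite ge_min lexx orbT.
  lra.
have c1 : 0 < 1 + c by lra.
(* Where Ric is dominated, eta' (1 + |Ric|) <= eta' (1 + c) (1 + |scal|) = eta (1 + |scal|). *)
pose eta' := eta / (1 + c).
have eta'0 : 0 < eta' by rewrite divr_gt0.
have eta'E : eta' * (1 + c) = eta by rewrite divfK// gt_eqF.
have eta'c : 0 <= eta' * c by rewrite mulr_ge0 ?ltW.
have eta'1 : eta' <= eta by lra.
have [r r0 rP] := Ck_ball_close M eta'0; exists r => // g h gh v sv cv ricv.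
have hg (f : M -> \bar R) : (forall x, 0 <= f x)%E ->
    measurable_fun setT (f : borel M -> \bar R) ->
    (\int[vol h]_x f x <= (1 + eta)%:E * \int[vol g]_x f x)%E.
  apply: le_integral_vol; first lra.
  move=> k x kx; have [h1 _ _ _] := rP g h gh k x kx.
  by apply: le_trans h1 _; rewrite ler_wpM2r ?sqrtr_ge0//; lra.
have gh' (f : M -> \bar R) : (forall x, 0 <= f x)%E ->
    measurable_fun setT (f : borel M -> \bar R) ->
    (\int[vol g]_x f x <= (1 + eta)%:E * \int[vol h]_x f x)%E.
  apply: le_integral_vol; first lra.
  move=> k x kx; have [_ h1 _ _] := rP g h gh k x kx.
  by apply: le_trans h1 _; rewrite ler_wpM2r ?sqrtr_ge0//; lra.
have e01 : 0 <= eta <= 1 by rewrite ltW.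
have uF x : `|energy_density g v x| <= energy_majorant g v x.
  rewrite /energy_density /energy_majorant.
  apply: le_trans (ler_normD _ _) _; rewrite ger0_norm; last first.
    by rewrite mulr_ge0 ?sqr_ge0 ?yamabe_coef_ge0.
  rewrite lerD2l normrM (ger0_norm (sqr_ge0 (v x))) ler_wpM2r ?sqr_ge0//; lra.
have wu x : `|energy_density h v x - energy_density g v x| <=
    eta * energy_majorant g v x.
  have [k kx] := pieceP x; have [_ _ h3 h4] := rP g h gh k x kx.
  rewrite /energy_density /energy_majorant.
  set dh := differential_norm h v x; set dg := differential_norm g v x.
  have -> : a * dh ^+ 2 + scal h x * v x ^+ 2 - (a * dg ^+ 2 + scal g x * v x ^+ 2)
    = a * (dh ^+ 2 - dg ^+ 2) + (scal h x - scal g x) * v x ^+ 2 by ring.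
  apply: le_trans (ler_normD _ _) _; rewrite [X in _ <= X]mulrDr; apply: lerD.
    rewrite normrM (ger0_norm yamabe_coef_ge0) [X in _ <= X]mulrCA ler_wpM2l ?yamabe_coef_ge0//.
    by apply: le_trans (h3 v) _; rewrite ler_wpM2r ?sqr_ge0.
  rewrite normrM (ger0_norm (sqr_ge0 (v x))).
  (* Where [v] vanishes the curvature error carries the factor 0, so the Ricci bound is only called
     for where [v] does not vanish. *)
  have [->|vx] := eqVneq (v x) 0; first by rewrite expr0n !mulr0.
  rewrite [X in _ <= X]mulrA ler_wpM2r ?sqr_ge0//; apply: le_trans h4 _.
  rewrite -eta'E -mulrA ler_wpM2l ?(ltW eta'0)//.
  have := ricv x vx; have := normr_ge0 (scal g x); lra.
have [Q1 Q2] := @integral_perturb _ (borel M) R (vol g) (vol h) eta e01 hg gh'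
  (energy_majorant g v) (energy_majorant_ge0 g v) (measurable_energy_majorant g sv)
  (energy_majorant_lty g sv cv) (energy_density g v) (energy_density h v)
  uF (measurable_energy_density g sv) (measurable_energy_density h sv) wu.
rewrite !energyE.
apply: le_trans (@quotient_perturb _ (mass g v) (mass h v) _ _ (majorant_int g v) eta
  e01 (sqr_ge0 _) (sqr_ge0 _) (mass_perturb (ltW eta0) sv cv hg)
  (mass_perturb (ltW eta0) sv cv gh') Q1 Q2) _.
rewrite ler_wpM2r//; rewrite divr_ge0 ?sqr_ge0//.
by apply: fine_ge0; apply: integral_ge0 => x _; rewrite lee_fin energy_majorant_ge0.
Qed.

End TestFunctions.

(** * Semicontinuity of the Yamabe map *)

#[local] Opaque energy vol.

Section Semicontinuity.
Context {R : realType} {n : nat} (M : manifold R n).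
Hypothesis n3 : (3 <= n)%N.
Implicit Types (g h : metric M) (v : M -> R).

Local Notation pc := (@piece R n M).
Local Notation p := (@crit_exp R n).

Lemma majorant_quotient_ge0 g v : 0 <= majorant_int g v / mass g v.
Proof.
rewrite divr_ge0 ?sqr_ge0//; apply: fine_ge0; apply: integral_ge0 => x _.
by rewrite lee_fin energy_majorant_ge0.
Qed.

Lemma energy_usc g v (e : R) : test_fun v -> 0 < e -> exists2 r : R, 0 < r &
  forall h, Ck_ball 2 g r h -> energy h v <= energy g v + e.
Proof.
move=> [sv cv _ _] e0; have [N NP] := compact_supp_pieces cv.
have [C C0 CP] := chartwise_bounded_lt N (chartwise_ric_norm g).
have C1 : 0 < 1 + C by lra.
pose K := majorant_int g v / mass g v.
have K0 : 0 <= K by exact: majorant_quotient_ge0.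
have K1 : 0 < K + 1 by lra.
have [r r0 rP] := energy_close M n3 C1 (divr_gt0 e0 K1).
exists r => // h gh; have := rP g h gh v sv cv _.
have ricv x : v x != 0 -> ric_norm g x <= (1 + C) * (1 + `|scal g x|).
  move=> vx; have [k kx] := pieceP x; have [Nk|kN] := leqP N k.
    by exfalso; apply: (NP k x Nk kx); exact: subset_closure.
  have h1 := le_trans (ler_norm _) (CP k x kN kx).
  (* [C] bounds the square of the norm; t <= (1 + t^2) / 2 turns this into a bound on the norm
     itself. *)
  have h2 := sqr_ge0 (ric_norm g x - 1).
  have h3 : 0 <= C * `|scal g x| by rewrite mulr_ge0// ltW.
  have := normr_ge0 (scal g x); lra.
move=> /(_ ricv); rewrite -/K => h1.
have h2 : e / (K + 1) * K <= e.
  by rewrite mulrAC ler_pdivrMr// ler_wpM2l ?ltW//; lra.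
by move: (le_trans (ler_norm _) (le_trans h1 h2)); rewrite lerBlDl.
Qed.

(** Phrased with a strict real upper bound [b], so that it serves finite values and the value -oo
    alike. A test function with energy below [b] for [g] keeps energy at most [b] nearby. *)
Lemma yamabe_usc g (b : R) : (yamabe g < b%:E)%E -> exists2 r : R, 0 < r &
  forall h, Ck_ball 2 g r h -> (yamabe h <= b%:E)%E.
Proof.
move=> /ereal_inf_lt[_ [v tv <-]]; rewrite lte_fin => vb.
have e0 : 0 < b - energy g v by rewrite subr_gt0.
have [r r0 rP] := energy_usc g tv e0; exists r => // h gh.
apply: le_trans (_ : (energy h v)%:E <= _)%E.
  by apply: ereal_inf_lbound; exists v.
by rewrite lee_fin; apply: le_trans (rP h gh) _; rewrite addrC subrK.
Qed.

Lemma negpart_ge0 (t : R) : 0 <= negpart t.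
Proof. by rewrite /negpart oppr_ge0 ge_min lexx. Qed.

(** For s >= eps the summand 1 is at most s / eps. For s < eps the right side equals 1 + 2 eps - s,
    which is at least 1 + |s| for either sign of s. *)
Lemma negpart_bound (s eps : R) : 0 < eps ->
  1 + `|s| <= (1 + eps^-1) * s + (2 + eps^-1) * negpart (s - eps).
Proof.
move=> e0; have i0 : 0 < eps^-1 by rewrite invr_gt0.
have ie : eps^-1 * eps = 1 by rewrite mulVf ?gt_eqF.
rewrite /negpart; have [se|se] := leP eps s.
  rewrite min_l ?subr_ge0// ger0_norm; last by rewrite (le_trans (ltW e0)).
  have := ler_wpM2l (ltW i0) se; lra.
rewrite min_r ?subr_le0 ?ltW//.
by have [s0|s0] := leP 0 s; [rewrite ger0_norm//|rewrite ltr0_norm//]; lra.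
Qed.

Lemma measurable_negpart g (eps : R) :
  measurable_fun setT (fun x : borel M => negpart (scal g x - eps)).
Proof.
rewrite /negpart; apply: measurable_funN; apply: measurable_minr => //.
by apply: measurable_funB => //; exact: measurable_scal.
Qed.

Lemma mass_powR g v : smooth_fun v -> compactly_supported v ->
  ((\int[vol g]_x (`|v x| `^ p)%:E) `^ (p^-1 * 2) = (mass g v)%:E)%E.
Proof.
move=> sv cv; rewrite /mass /Lp_norm fine_poweR poweRrM.
have fin : (\int[vol g]_x (`|v x| `^ p)%:E \is a fin_num)%E.
  rewrite ge0_fin_numE; first exact: Lp_int_lty.
  by apply: integral_ge0 => x _; rewrite lee_fin powR_ge0.
by rewrite -(fineK fin) !poweR_EFin powR_mulrn ?powR_ge0.
Qed.

(** Hoelder with the conjugate exponents n/2 and n/(n-2). The second is p/2, so the corresponding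
    norm of v^2 is the squared L^p norm of v; this is the origin of n/2 in the hypothesis on
    scal. *)
Lemma negpart_hoelder g v (eps : R) : smooth_fun v -> compactly_supported v ->
  (\int[vol g]_x (negpart (scal g x - eps) * v x ^+ 2)%:E <=
   Lp_norm g (n%:R / 2) (fun x => negpart (scal g x - eps)%R) * (mass g v)%:E)%E.
Proof.
move=> sv cv; have n3' : 3 <= n%:R :> R := dim_ge3 n3.
have q0 : 0 < n%:R / (n%:R - 2) :> R by rewrite divr_gt0//; lra.
have r0 : 0 < n%:R / 2 :> R by rewrite divr_gt0//; lra.
have mf := measurable_negpart g eps.
have mg : measurable_fun setT (fun x : borel M => v x ^+ 2).
  by apply: measurable_funX; exact: measurable_smooth.
have := hoelder (vol g) mf mg r0 q0; rewrite Lnorm1 => /(_ _) h.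
have -> : (\int[vol g]_x (negpart (scal g x - eps) * v x ^+ 2)%:E =
    \int[vol g]_x `|(negpart (scal g x - eps) * v x ^+ 2)%:E|)%E.
  apply: eq_integral => x _; rewrite gee0_abs// lee_fin mulr_ge0 ?sqr_ge0//.
  exact: negpart_ge0.
apply: le_trans (h _) _; first by field; lra.
rewrite unlock lee_wpmul2l ?poweR_ge0//.
rewrite -(mass_powR g sv cv) le_eqVlt; apply/orP; left; apply/eqP.
have -> : (n%:R / (n%:R - 2) : R)^-1 = p^-1 * 2.
  by rewrite /crit_exp; field; lra.
congr (_ `^ _)%E; apply: eq_integral => x _ /=.
congr EFin.
rewrite normrX -powR_mulrn// -powRrM; congr (_ `^ _).
by rewrite /crit_exp; field; lra.
Qed.

(** [negpart_bound] times v^2, integrated; the gradient term only gains from the factor 1 + 1/eps >=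
    1. *)
Lemma majorant_le g v (eps : R) : 0 < eps ->
  smooth_fun v -> compactly_supported v ->
  (Lp_norm g (n%:R / 2) (fun x => negpart (scal g x - eps)%R) < +oo)%E ->
  majorant_int g v <=
  (1 + eps^-1) * fine (\int[vol g]_x (energy_density g v x)%:E)%E +
  (2 + eps^-1) *
    (fine (Lp_norm g (n%:R / 2) (fun x => negpart (scal g x - eps))) * mass g v).
Proof.
move=> e0 sv cv; set L := Lp_norm _ _ _ => Loo.
have i0 : 0 < eps^-1 by rewrite invr_gt0.
have L0 : (0 <= L)%E by exact: poweR_ge0.
have Lfin : L \is a fin_num by rewrite ge0_fin_numE.
pose w x := negpart (scal g x - eps) * v x ^+ 2.
have w0 x : 0 <= w x by rewrite mulr_ge0 ?sqr_ge0 ?negpart_ge0.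
have mw : measurable_fun setT (w : borel M -> R).
  apply: measurable_funM; first exact: measurable_negpart.
  by apply: measurable_funX; exact: measurable_smooth.
have wL : (\int[vol g]_x (w x)%:E <= L * (mass g v)%:E)%E.
  exact: negpart_hoelder.
have iw : (vol g).-integrable setT (EFin \o (w : borel M -> R)).
  apply/integrableP; split; first exact/measurable_EFinP.
  under eq_integral do rewrite /= ger0_norm//.
  by apply: le_lt_trans wL _; rewrite -(fineK Lfin) -EFinM ltry.
have iF : (vol g).-integrable setT (EFin \o (energy_majorant g v : borel M -> R)).
  apply/integrableP; split.
    by apply/measurable_EFinP; exact: measurable_energy_majorant.
  under eq_integral do rewrite /= ger0_norm ?energy_majorant_ge0//.
  exact: energy_majorant_lty.
have iq : (vol g).-integrable setT (EFin \o (energy_density g v : borel M -> R)).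
  apply: le_integrable iF => //.
    by apply/measurable_EFinP; exact: measurable_energy_density.
  move=> x _; rewrite /= lee_fin (ger0_norm (energy_majorant_ge0 n3 g v x)).
  rewrite /energy_density /energy_majorant; apply: le_trans (ler_normD _ _) _.
  rewrite ger0_norm; last by rewrite mulr_ge0 ?sqr_ge0 ?yamabe_coef_ge0.
  by rewrite lerD2l normrM (ger0_norm (sqr_ge0 (v x))) ler_wpM2r ?sqr_ge0//; lra.
have iA := integrableZl measurableT (1 + eps^-1) iq.
have iB := integrableZl measurableT (2 + eps^-1) iw.
apply: (@le_trans _ _ (\int[vol g]_x
    ((1 + eps^-1) * energy_density g v x + (2 + eps^-1) * w x))).
  apply: le_Rintegral => //; first exact: (integrableD measurableT iA iB).
  move=> x _; rewrite /energy_majorant /energy_density /w.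
  have a0 : 0 <= @yamabe_coef R n * differential_norm g v x ^+ 2.
    by rewrite mulr_ge0 ?sqr_ge0 ?yamabe_coef_ge0.
  have h1 := ler_wpM2r (sqr_ge0 (v x)) (negpart_bound (scal g x) e0).
  have := mulr_ge0 (ltW i0) a0; lra.
rewrite RintegralD// !RintegralZl// lerD2l ler_wpM2l//; first lra.
rewrite -lee_fin /Rintegral fineK; last exact: integrable_fin_num.
by rewrite EFinM (fineK Lfin).
Qed.

(** Eh >= (1 - e' A) Eg - e' B, and as e' A <= 1 the right side increases with Eg. So Eg may be
    replaced by its lower bound [r], however large it is. *)
Lemma lower_bound_arith (r e A B e' Eg Eh K : R) : 0 <= A -> 0 <= B -> 0 <= e' ->
  e' * (A * `|r| + B) <= e -> e' * A <= 1 -> r <= Eg -> K <= A * Eg + B ->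
  `|Eh - Eg| <= e' * K -> r - e <= Eh.
Proof.
move=> A0 B0 e'0 h1 h2 rE KE; rewrite ler_norml => /andP[h3 _].
have h4 := ler_wpM2l e'0 KE.
have h5 : 0 <= (1 - e' * A) * (Eg - r) by rewrite mulr_ge0// subr_ge0.
have h6 : e' * A * r <= e' * A * `|r| by rewrite ler_wpM2l ?mulr_ge0// ler_norm.
lra.
Qed.

Lemma yamabe_lsc g (r eps c e : R) : yamabe g = r%:E -> 0 < eps -> 0 < c ->
  (forall x : M, ric_norm g x <= c * (1 + `|scal g x|)) ->
  (Lp_norm g (n%:R / 2) (fun x => negpart (scal g x - eps)%R) < +oo)%E ->
  0 < e -> exists2 d : R, 0 < d &
  forall h, Ck_ball 2 g d h -> (r%:E - e%:E <= yamabe h)%E.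
Proof.
move=> yg eps0 c0 ric Loo e0.
have i0 : 0 < eps^-1 by rewrite invr_gt0.
pose L := fine (Lp_norm g (n%:R / 2) (fun x => negpart (scal g x - eps))).
have L0 : 0 <= L by apply: fine_ge0; exact: poweR_ge0.
pose A := 1 + eps^-1; pose B := (2 + eps^-1) * L.
have A0 : 0 <= A by rewrite /A; lra.
have B0 : 0 <= B by rewrite mulr_ge0//; lra.
have Ar0 : 0 <= A * `|r| by rewrite mulr_ge0.
have Ae0 : 0 <= A * e by rewrite mulr_ge0// ltW.
(* The first two summands give e/D (A |r| + B) <= e, the third gives (e/D) A <= 1, and the last
   makes [D] positive. *)
pose D := A * `|r| + B + A * e + 1.
have D0 : 0 < D by rewrite /D; lra.
have e'0 : 0 < e / D by rewrite divr_gt0.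
have e'D : e / D * D = e by rewrite divfK// gt_eqF.
have h1 : e / D * (A * `|r| + B) <= e.
  by rewrite -[X in _ <= X]e'D ler_wpM2l ?(ltW e'0)// /D; lra.
have h2 : e / D * A <= 1.
  have AeD : A * e <= D by rewrite /D; lra.
  by rewrite -(ler_pM2r e0) mul1r; have := ler_wpM2l (ltW e'0) AeD; rewrite e'D mulrA.
have [d d0 dP] := energy_close M n3 c0 e'0; exists d => // h gh.
apply: le_ereal_inf_tmp => _ [v [sv cv v0 vx] <-]; rewrite -EFinB lee_fin.
have Ev : r <= energy g v.
  by rewrite -lee_fin -yg; apply: ereal_inf_lbound; exists v.
have := dP g h gh v sv cv (fun x _ => ric x).
apply: (lower_bound_arith A0 B0 (ltW e'0) h1 h2 Ev).
have := majorant_le eps0 sv cv Loo; rewrite -/L -/A energyE.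
have := sqr_ge0 _ : 0 <= mass g v.
move: (majorant_int g v) (mass g v) (fine _) => P m Q m0 PQ.
(* Since 0^-1 = 0, the quotient is 0 or 1, which also covers a vanishing mass. *)
have m1 : m / m <= 1 by have [->|m1] := eqVneq m 0; [rewrite mul0r|rewrite divff].
have mi : 0 <= m^-1 by rewrite invr_ge0.
apply: le_trans (ler_wpM2r mi PQ) _.
have := ler_wpM2l B0 m1; rewrite /B; lra.
Qed.

Lemma metr_nbhs g (r : R) : 0 < r -> nbhs (g : metr 2 M) (Ck_ball 2 g r).
Proof. by move=> r0; exists r. Qed.

End Semicontinuity.

Theorem theorem1p2 (R : realType) (n : nat) (hn : (3 <= n)%N)
    (M : manifold R n) :
  usc (fun g : metr 2 M => yamabe g) /\
  (forall g : metr 2 M,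
    (yamabe g = -oo%E \/
     exists eps c : R,
       [/\ 0 < eps, 0 < c,
           forall x : M, ric_norm g x <= c * (1 + `|scal g x|) &
           (Lp_norm g (n%:R / 2) (fun x => negpart (scal g x - eps))
              < +oo)%E]) ->
    sc_continuous_at (fun h : metr 2 M => yamabe h) g).
Proof.
have uscM : usc (fun g : metr 2 M => yamabe g).
  move=> g; rewrite /usc_at; case yg : (yamabe g) => [r| |]//.
    move=> e e0; have [|d d0 dP] := @yamabe_usc _ _ M hn g (r + e).
      by rewrite yg lte_fin ltrDl.
    by exists (Ck_ball 2 g d); [exact: metr_nbhs|rewrite -EFinD].
  move=> c; have [|d d0 dP] := @yamabe_usc _ _ M hn g c; first by rewrite yg ltNyr.
  by exists (Ck_ball 2 g d); [exact: metr_nbhs|].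
split => // g hg; split; first exact: uscM.
(* At the value -oo lower semicontinuity is void; at a real value only the second alternative can
   hold. *)
rewrite /lsc_at; case yg : (yamabe g) hg => [r| |]// [//|[eps [c [e0 c0 ric Loo]]]].
move=> e e1; have [d d0 dP] := yamabe_lsc hn yg e0 c0 ric Loo e1.
by exists (Ck_ball 2 g d); [exact: metr_nbhs|].
Qed.
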